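(* Let $1\le d\le n$ and let $\alpha\ne0$ be real. Let $\mathfrak a\subset\mathfrak{so}(n)$ be the subalgebra of matrices whose top-left $d\times d$ block is antisymmetric and whose remaining entries vanish. For $\beta_0=-\frac12$ and $\mathcal B=\alpha I_{\mathfrak a}$, equip $\mathrm{SO}(n)$ with the left-invariant metric induced by the form $\langle\mathtt X_1,\mathtt X_2\rangle_{\vec\beta}=\beta_0\operatorname{Tr}\mathtt X_1\mathtt X_2-(\alpha+\beta_0)\operatorname{Tr}(\mathcal P_{\mathfrak a}\mathtt X_1)(\mathcal P_{\mathfrak a}\mathtt X_2)$ on $\mathfrak{so}(n)$. At $X\in\mathrm{SO}(n)$, let $\xi=X\begin{bmatrix}A_\xi & -B_\xi^{\mathsf T} \\ B_\xi & C_\xi\end{bmatrix}$, $\eta=X\begin{bmatrix}A_\eta & -B_\eta^{\mathsf T} \\ B_\eta & C_\eta\end{bmatrix}$ be tangent vectors in $T_X\mathrm{SO}(n)$, with $A_\xi,A_\eta\in\mathfrak{so}(d)$, $C_\xi,C_\eta\in\mathfrak{so}(n-d)$. Then the metric is $$\langle\xi,\eta\rangle=\tfrac12\operatorname{Tr}\xi^{\mathsf T}\eta+(\alpha-\tfrac12)\operatorname{Tr}\big(\mathcal P_{\mathfrak a}(\xi^{\mathsf T}X)\mathcal P_{\mathfrak a}(X^{\mathsf T}\eta)\big)=\tfrac12\operatorname{Tr}\xi^{\mathsf T}\eta+(\alpha-\tfrac12)\operatorname{Tr}A_\xi^{\mathsf T}A_\eta.$$ The Christoffel function of the Levi-Civita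 connection is $$\Gamma(\xi,\eta)=\tfrac12X(\xi^{\mathsf T}\eta+\eta^{\mathsf T}\xi)+\tfrac{1-2\alpha}2X\big([\mathcal P_{\mathfrak a}(X^{\mathsf T}\xi),X^{\mathsf T}\eta]+[\mathcal P_{\mathfrak a}(X^{\mathsf T}\eta),X^{\mathsf T}\xi]\big)$$ $$=\tfrac12X(\xi^{\mathsf T}\eta+\eta^{\mathsf T}\xi)+\tfrac{1-2\alpha}2X\begin{bmatrix}0_{d\times d} & -A_\xi B_\eta^{\mathsf T}-A_\eta B_\xi^{\mathsf T} \\ -B_\eta A_\xi-B_\xi A_\eta & 0_{(n-d)\times(n-d)}\end{bmatrix}.$$ The geodesic $\gamma(t)$ with $\gamma(0)=X$, $\dot\gamma(0)=\xi$ is $$\gamma(t)=X\exp\!\left(t\begin{bmatrix}2\alpha A_\xi & -B_\xi^{\mathsf T} \\ B_\xi & C_\xi\end{bmatrix}\right)\exp\!\left(t\begin{bmatrix}(1-2\alpha)A_\xi & 0 \\ 0 & 0\end{bmatrix}\right).$$ Parallel transport of $\eta$ along $\gamma(t)$ is $$\mathtt T_0^t(\gamma)\eta=X\exp\!\left(t\begin{bmatrix}2\alpha A_\xi & -B_\xi^{\mathsf T} \\ B_\xi & C_\xi\end{bmatrix}\right)\operatorname{expv}(t\mathrm P,X^{\mathsf T}\eta)\exp\!\left(t\begin{bmatrix}(1-2\alpha)A_\xi & 0 \\ 0 & 0\end{bmatrix}\right),$$ where $\mathrm P=\mathrm P_{\mathtt V}$, $\mathtt V=X^{\mathsf T}\xi$,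 is the operator on $\mathfrak{so}(n)$ given by $$\mathrm P_{\mathtt V}:\mathtt B\mapsto\tfrac12\big([\mathtt B,\mathtt V]+(1-2\alpha)[\mathcal P_{\mathfrak a}\mathtt V,\mathtt B]-(1-2\alpha)[\mathcal P_{\mathfrak a}\mathtt B,\mathtt V]\big).$$
   Context: $\mathfrak{so}(n)$ is identified with the antisymmetric $n\times n$ matrices, and $T_X\mathrm{SO}(n)=X\mathfrak{so}(n)$. $\mathcal P_{\mathfrak a}$ maps a matrix to the matrix whose top-left $d\times d$ block is the antisymmetrization $\frac12(M-M^{\mathsf T})$ of the corresponding block $M$ and whose other entries vanish. The metric at $X$ is $\langle\xi,\eta\rangle_X=\langle X^{-1}\xi,X^{-1}\eta\rangle_{\vec\beta}$ (Riemannian for $\alpha>0$). The Christoffel function is defined by $\nabla_{\mathtt Y}\mathtt Z=\mathrm D_{\mathtt Y}\mathtt Z+\Gamma(\mathtt Y,\mathtt Z)$ with vector fields regarded as matrix-valued functions and $\mathrm D$ the directional derivative. $[\cdot,\cdot]$ is the matrix commutator, $\exp$ the matrix exponential, and $\operatorname{expv}(t\mathrm P,v)=e^{t\mathrm P}v$ for a linear operator $\mathrm P$ on a matrix space. Blocks of size zero are allowed. *)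

(* Defs.v *)
From HB Require Import structures.
From mathcomp Require Import all_boot all_order all_algebra.
From mathcomp Require Import all_classical all_reals all_analysis.

Set Implicit Arguments.
Unset Strict Implicit.
Unset Printing Implicit Defensive.

Import Order.TTheory GRing.Theory Num.Theory.
Import numFieldNormedType.Exports.

Local Open Scope classical_set_scope.
Local Open Scope ring_scope.

Section Smooth.
Context {R : realType} {V W : normedModType R}.

Fixpoint class_C (k : nat) (f : V -> W) : Prop :=
  if k is k'.+1 then
    (forall x, differentiable f x) /\
    (forall v, class_C k' (fun x => 'D_v f x))
  else continuous f.

Definition smooth (f : V -> W) : Prop := forall k, class_C k f.

End Smooth.

Section MatrixExponential.
Context {R : realType}.

Definition mexp {n} (M : 'M[R]_n) : 'M[R]_n :=
  limn (series (fun k : nat => (k`!%:R)^-1 *: M ^+ k)).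

(* expv P v = e^P v, for a linear operator P on a space of matrices. *)
Definition expv {m n} (P : 'M[R]_(m, n) -> 'M[R]_(m, n)) (v : 'M[R]_(m, n)) :
    'M[R]_(m, n) :=
  limn (series (fun k : nat => (k`!%:R)^-1 *: iter k P v)).

End MatrixExponential.

Section SpecialOrthogonalGroup.
Context {R : realType} {n : nat}.
Local Notation M := 'M[R]_n.

Definition SO : set M := [set X | X^T *m X = 1%:M /\ \det X = 1].

Definition so : set M := [set V | V^T = - V].

Definition tangent_SO (X : M) : set M := [set X *m V | V in so].

Definition commutator_mx (A B : M) : M := A *m B - B *m A.

(* A vector field on SO(n) is a matrix-valued function that is tangent along
   SO(n).  As SO(n) is a closed submanifold of the space of matrices, every
   smooth function on SO(n) is the restriction of a smooth function on the
   whole space; fields and scalar functions are represented by such extensions.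
   Everything below evaluates them only at points of SO(n) and differentiates
   them only along tangent directions of SO(n). *)
Definition vector_field (Y : M -> M) : Prop :=
  smooth Y /\ (forall X, SO X -> tangent_SO X (Y X)).

Definition lie_bracket (Y Z : M -> M) (X : M) : M :=
  'D_(Y X) Z X - 'D_(Z X) Y X.

(* Two extensions of the same field are identified by [connection_ext]. *)
Record affine_connection (nabla : (M -> M) -> (M -> M) -> (M -> M)) : Prop := {
  connection_field : forall Y Z, vector_field Y -> vector_field Z ->
    vector_field (nabla Y Z);
  connection_ext : forall Y Y' Z Z',
    vector_field Y -> vector_field Y' -> vector_field Z -> vector_field Z' ->
    {in SO, Y =1 Y'} -> {in SO, Z =1 Z'} ->
    {in SO, nabla Y Z =1 nabla Y' Z'};
  connection_linear : forall (f : M -> R) Y Y' Z,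
    smooth (f : M -> R^o) ->
    vector_field Y -> vector_field Y' -> vector_field Z ->
    forall X, SO X ->
      nabla (fun x => f x *: Y x + Y' x) Z X =
      f X *: nabla Y Z X + nabla Y' Z X;
  connection_leibniz : forall (f : M -> R) Y Z Z',
    smooth (f : M -> R^o) ->
    vector_field Y -> vector_field Z -> vector_field Z' ->
    forall X, SO X ->
      nabla Y (fun x => f x *: Z x + Z' x) X =
      'D_(Y X) (f : M -> R^o) X *: Z X + f X *: nabla Y Z X + nabla Y Z' X
}.

Definition torsion_free (nabla : (M -> M) -> (M -> M) -> (M -> M)) : Prop :=
  forall Y Z, vector_field Y -> vector_field Z -> forall X, SO X ->
    nabla Y Z X - nabla Z Y X = lie_bracket Y Z X.

Definition metric_compatible (g : M -> M -> M -> R)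
    (nabla : (M -> M) -> (M -> M) -> (M -> M)) : Prop :=
  forall Y Z W, vector_field Y -> vector_field Z -> vector_field W ->
  forall X, SO X ->
    'D_(Y X) ((fun x => g x (Z x) (W x)) : M -> R^o) X =
    g X (nabla Y Z X) (W X) + g X (Z X) (nabla Y W X).

Definition levi_civita (g : M -> M -> M -> R)
    (nabla : (M -> M) -> (M -> M) -> (M -> M)) : Prop :=
  [/\ affine_connection nabla, torsion_free nabla & metric_compatible g nabla].

(* nabla_Y Z = D_Y Z + Gamma(Y, Z); only the values of [Gam X] at pairs of
   vectors tangent to SO(n) at X are meaningful. *)
Definition christoffel_function (nabla : (M -> M) -> (M -> M) -> (M -> M))
    (Gam : M -> M -> M -> M) : Prop :=
  forall Y Z, vector_field Y -> vector_field Z -> forall X, SO X ->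
    nabla Y Z X = 'D_(Y X) Z X + Gam X (Y X) (Z X).

(* Covariant derivative, for nabla = D + Gamma, of the field E along c. *)
Definition covariant_derivative (Gam : M -> M -> M -> M) (c E : R -> M)
    (t : R) : M :=
  derive1 E t + Gam (c t) (derive1 c t) (E t).

Definition parallel_along (Gam : M -> M -> M -> M) (c E : R -> M) : Prop :=
  forall t, [/\ tangent_SO (c t) (E t), derivable E t 1 &
                covariant_derivative Gam c E t = 0].

Definition geodesic (Gam : M -> M -> M -> M) (c : R -> M) : Prop :=
  forall t, [/\ SO (c t), derivable c t 1, derivable (derive1 c) t 1 &
                covariant_derivative Gam c (derive1 c) t = 0].

Definition left_invariant_metric (b : M -> M -> R) (X xi eta : M) : R :=
  b (invmx X *m xi) (invmx X *m eta).

End SpecialOrthogonalGroup.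

(* Here n = d + m, with m possibly zero. *)
Section Block.
Context {R : realType} {d m : nat}.
Local Notation M := 'M[R]_(d + m).

Definition proj_a (V : M) : M :=
  block_mx (2^-1 *: (ulsubmx V - (ulsubmx V)^T)) 0 0 0.

Definition form_beta (beta0 alpha : R) (V1 V2 : M) : R :=
  beta0 * \tr (V1 *m V2) - (alpha + beta0) * \tr (proj_a V1 *m proj_a V2).

Definition transport_op (alpha : R) (V B : M) : M :=
  2^-1 *: (commutator_mx B V
           + (1 - 2 * alpha) *: commutator_mx (proj_a V) B
           - (1 - 2 * alpha) *: commutator_mx (proj_a B) V).

End Block.

(* Main.v *)
Require Import Defs.
From HB Require Import structures.
From mathcomp Require Import all_boot all_order all_algebra.
From mathcomp Require Import all_classical all_reals all_analysis.
From mathcomp Require Import ring.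

Set Implicit Arguments.
Unset Strict Implicit.
Unset Printing Implicit Defensive.

Import Order.TTheory GRing.Theory Num.Theory.
Import numFieldNormedType.Exports.

Local Open Scope classical_set_scope.
Local Open Scope ring_scope.

(** Left translation identifies T_X SO(n) with so(n), and on left-invariant
    fields X V and X A everything becomes algebra in so(n).  The formula for
    Gamma says that the covariant derivative of X A along X V is X times
    [V, A]/2 + (1 - 2 alpha)/2 ([P V, A] + [P A, V]), called [left_connection]
    below, where P is the projection onto a.  It differs from [V, A] / 2 by an
    expression symmetric in V and A, which gives torsion-freeness.  Metric
    compatibility ([left_connection_skew]) is a cancellation in the alternating
    form tr([u, v] w): the properties of P that matter are that it is
    self-adjoint for the trace and commutes with brackets by elements of a
    ([trace_proj_a], [proj_a_commutator]).  So D + Gamma is a Levi-Civita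
    connection ([levi_civita_metric_connection]).  A Levi-Civita connection is
    unique since the form is nondegenerate when alpha is not zero
    ([form_beta_nondeg], [levi_civita_unique]), and this determines the
    Christoffel function on tangent vectors ([christoffel_unique]).

    Let V = X^T xi, K = (1 - 2 alpha) P V and U = V - K.  Write a curve of
    matrices as L F q, with L = X exp(tU) and q = exp(tK).  For F = 1 this is
    the curve gamma, whose velocity is L V q.  Conjugation by q preserves the
    connection, because q commutes with the projector that defines P, and the
    covariant derivative of L F q along gamma turns out to be L (F' - P_V F) q
    ([covariant_derivative_framed]).  Hence a field is parallel exactly when
    F' = P_V F, that is F = exp(t P_V) F(0), and gamma is a geodesic because
    P_V V = 0.

    For the converse, the body velocity v = c^T c' of a geodesic c satisfies
    v' = - (1 - 2 alpha) [P v, v].  Applying P gives (P v)' = 0, so P v = P V and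
    the equation is the linear one v' = - [K, v]; integrating it and then
    c' = c v gives c = gamma ([geodesic_unique]).  All uniqueness statements for
    differential equations rest on the integrating factor exp(-tM) and on the
    fact that a matrix function with zero derivative is constant
    ([linear_ode_unique], [operator_ode_unique]). *)

(** * Entrywise calculus of matrix-valued functions *)

Section EntrywiseCalculus.
Context {R : realType}.

Lemma cvg_mx (T : Type) (F : set_system T) (FF : Filter F) (p q : nat)
    (u : T -> 'M[R]_(p, q)) (l : 'M[R]_(p, q)) :
  (forall i j, (fun x => u x i j) @ F --> l i j) -> u @ F --> l.
Proof.
move=> ul; apply/cvgrPdist_le => /= e e0; near=> x.
rewrite /Num.Def.normr/= mx_normrE (bigmax_le _ (ltW e0))//= => i _.
rewrite !mxE/=.
move: i; near: x; apply: filter_forall => /= i.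
exact: ((cvgrPdist_le _ _).1 (ul i.1 i.2)).
Unshelve. all: by end_near. Qed.

Lemma is_derive_mxP (V : normedModType R) (p q : nat) (F : V -> 'M[R]_(p, q))
    (x v : V) (dF : 'M[R]_(p, q)) :
  is_derive x v F dF <->
  forall i j, is_derive x v (fun y => F y i j) (dF i j).
Proof.
split=> [[Fx <-] i j|Fx].
  by rewrite derive_mx// mxE; apply: derivableP; move/derivable_mxP: Fx.
have dF' : derivable F x v by apply/derivable_mxP => i j; have [] := Fx i j.
apply: DeriveDef => //; rewrite derive_mx//; apply/matrixP => i j.
by rewrite mxE; have [] := Fx i j.
Qed.

Lemma continuous_linear_mx (W : normedModType R) (p q : nat)
    (L : {linear 'M[R]_(p, q) -> W}) : continuous L.
Proof.
have -> : (L : _ -> W) = fun M => \sum_i \sum_j M i j *: L (delta_mx i j).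
  apply/funext => M; rewrite [in LHS](matrix_sum_delta M) linear_sum.
  apply: eq_bigr => i _; rewrite linear_sum.
  by apply: eq_bigr => j _; rewrite linearZ.
apply: continuous_big => [|i _]; first exact: add_continuous.
apply: continuous_big => [|j _ M]; first exact: add_continuous.
by apply: (@cvgZr_tmp _ _ _ (nbhs M) _ _ (M i j)); apply: coord_continuous.
Qed.

Lemma cvg_linear_mx (W : normedModType R) (p q : nat)
    (L : {linear 'M[R]_(p, q) -> W}) (T : Type) (F : set_system T)
    (u : T -> 'M[R]_(p, q)) (l : 'M[R]_(p, q)) :
  u @ F --> l -> (fun x => L (u x)) @ F --> L l.
Proof. by move=> ul; apply: (cvg_comp _ L ul); apply: continuous_linear_mx. Qed.

Lemma is_derive_linear_mx (V W : normedModType R) (p q : nat)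
    (L : {linear 'M[R]_(p, q) -> W}) (F : V -> 'M[R]_(p, q)) (x v : V)
    (dF : 'M[R]_(p, q)) :
  is_derive x v F dF -> is_derive x v (fun y => L (F y)) (L dF).
Proof.
move=> [Fx <-].
have cvgL : (fun h => h^-1 *: (((fun y => L (F y)) \o shift x) (h *: v)
    - L (F x))) @ 0^' --> L ('D_v F x).
  rewrite (_ : (fun h => _) = L \o
    (fun h => h^-1 *: ((F \o shift x) (h *: v) - F x))); last first.
    by apply/funext => h; rewrite [RHS]linearZ (linearB L).
  apply: (cvg_comp _ L Fx).
  exact: continuous_linear_mx.
apply: DeriveDef; first by apply/cvg_ex; eexists; exact: cvgL.
exact: cvg_lim cvgL.
Qed.

Lemma is_derive_scalar_sum (V : normedModType R) (I : finType)
    (f : I -> V -> R) (x v : V) (df : I -> R) :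
  (forall i, is_derive x v (f i) (df i)) ->
  is_derive x v (fun y => \sum_i f i y) (\sum_i df i).
Proof.
move=> fx.
have -> : (fun y => \sum_i f i y) = \sum_i f i.
  by apply/funext => y; rewrite fct_sumE.
by elim/big_rec2: _ => [|i f' s _ ?]; [exact: is_derive_cst|exact: is_deriveD].
Qed.

Lemma is_derive_mulmx (V : normedModType R) (p q r : nat)
    (F : V -> 'M[R]_(p, q)) (G : V -> 'M[R]_(q, r)) (x v : V)
    (dF : 'M[R]_(p, q)) (dG : 'M[R]_(q, r)) :
  is_derive x v F dF -> is_derive x v G dG ->
  is_derive x v (fun y => F y *m G y) (dF *m G x + F x *m dG).
Proof.
move=> /is_derive_mxP Fx /is_derive_mxP Gx; apply/is_derive_mxP => i j.
under eq_fun do rewrite mxE.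
rewrite !mxE -big_split/=.
apply: is_derive_scalar_sum => k.
move/is_derive_eq: (is_deriveM (Fx i k) (Gx k j)); apply.
by rewrite addrC /GRing.scale/=; congr (_ + _); exact: mulrC.
Qed.

(** The only uniqueness principle for differential equations that is used below:
    every equation is brought to the form f' = 0 by an integrating factor. *)
Lemma is_derive_0_mx_cst (p q : nat) (F : R -> 'M[R]_(p, q)) :
  (forall t : R, is_derive t (1 : R) F 0) -> forall t, F t = F 0.
Proof.
move=> F0 t; apply/matrixP => i j.
apply: (@is_derive_0_is_cst _ (fun s => F s i j)) => s.
by have /is_derive_mxP/(_ i j) := F0 s; rewrite mxE.
Qed.

End EntrywiseCalculus.

Arguments cvg_linear_mx {R W p q} L {T F u l}.
Arguments is_derive_linear_mx {R V W p q} L {F x v dF}.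
Arguments continuous_linear_mx {R W p q} L.

(** * The matrix exponential *)

Section ExponentialSeries.
Context {R : realType} {n : nat}.
Implicit Types (M N : 'M[R]_n) (t : R).

(** The supremum norm is not submultiplicative; the factor n compensates for
    the n terms of each entry of a product. *)
Lemma mx_pow_entry_le M k i j :
  `|(M ^+ k) i j| <= (n%:R * `|M|) ^+ k.
Proof.
elim: k i j => [|k IH] i j.
  rewrite !expr0 mxE; case: (i == j); first by rewrite normr1.
  by rewrite normr0.
rewrite !exprS -mulmxE mxE; apply: le_trans (ler_norm_sum _ _ _) _.
have -> : n%:R * `|M| * (n%:R * `|M|) ^+ k =
    \sum_(l < n) `|M| * (n%:R * `|M|) ^+ k.
  by rewrite sumr_const card_ord -[RHS]mulr_natl mulrA.
apply: ler_sum => l _; rewrite normrM ler_pM//.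
rewrite /Num.Def.normr/= mx_normrE.
exact: (le_bigmax _ (fun i : 'I_n * 'I_n => `|M i.1 i.2|) (i, l)).
Qed.

Lemma is_cvg_pseries_mx_pow M i j t :
  cvgn (pseries (fun k => (k`!%:R)^-1 * (M ^+ k) i j) t).
Proof.
apply: normed_cvg.
apply: (@series_le_cvg _ _ (exp_coeff (n%:R * `|M| * `|t|))).
- by move=> k; exact: normr_ge0.
- by move=> k; apply: exp_coeff_ge0; rewrite !mulr_ge0.
- move=> k; rewrite exp_coeffE /= !normrM normfV normr_nat normrX -mulrA exprMn.
  by rewrite ler_wpM2l ?invr_ge0// ler_wpM2r ?exprn_ge0// mx_pow_entry_le.
exact: is_cvg_series_exp_coeff.
Qed.

Lemma expZmx M t k : (t *: M) ^+ k = t ^+ k *: M ^+ k.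
Proof.
elim: k => [|k IH]; first by rewrite !expr0 scale1r.
by rewrite !exprS -!mulmxE IH -scalemxAl -scalemxAr scalerA.
Qed.

Lemma series_mexp_entry M t i j k :
  series (fun k => (k`!%:R)^-1 *: (t *: M) ^+ k) k i j =
  pseries (fun k => (k`!%:R)^-1 * (M ^+ k) i j) t k.
Proof.
rewrite /pseries /series /= summxE; apply: eq_bigr => l _.
by rewrite expZmx !mxE mulrCA mulrC.
Qed.

Lemma cvg_mexp M t : series (fun k => (k`!%:R)^-1 *: (t *: M) ^+ k) @ \oo -->
  \matrix_(i, j) limn (pseries (fun k => (k`!%:R)^-1 * (M ^+ k) i j) t).
Proof.
apply: cvg_mx => i j; rewrite mxE.
under eq_cvg do rewrite series_mexp_entry.
exact: is_cvg_pseries_mx_pow.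
Qed.

(** Each entry of exp(tM) is an ordinary real power series in t, so convergence
    and termwise differentiation are inherited from real power series. *)
Lemma mexpE M t i j :
  mexp (t *: M) i j = limn (pseries (fun k => (k`!%:R)^-1 * (M ^+ k) i j) t).
Proof. by rewrite /mexp (cvg_lim (@norm_hausdorff _ _) (@cvg_mexp M t)) mxE. Qed.

Lemma is_cvg_mexp M :
  series (fun k => (k`!%:R)^-1 *: M ^+ k) @ \oo --> mexp M.
Proof.
have := @cvg_mexp M 1; rewrite scale1r => h.
by rewrite /mexp (cvg_lim (@norm_hausdorff _ _) h).
Qed.

Lemma pseries_diffs_mx_pow M i j :
  pseries_diffs (fun k => (k`!%:R)^-1 * (M ^+ k) i j) =
  (fun k => (k`!%:R)^-1 * (M ^+ k.+1) i j).
Proof.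
apply/funext => k; rewrite /pseries_diffs factS natrM invfM mulrA mulrA.
by rewrite mulfV ?mul1r// pnatr_eq0.
Qed.

(** The extra factor N covers at once the first two termwise derivatives of the
    series of exp(tM), which are those for N = M and N = M^2. *)
Lemma cvg_pseries_mexp_mul M N t i j :
  pseries (fun k => (k`!%:R)^-1 * (M ^+ k *m N) i j) t @ \oo -->
  (mexp (t *: M) *m N) i j.
Proof.
rewrite (_ : pseries _ t = (fun k => \sum_l
    pseries (fun k => (k`!%:R)^-1 * (M ^+ k) i l) t k * N l j)).
  rewrite mxE; apply: cvg_big => [|l _]; first exact: add_continuous.
  apply: cvgM; last exact: cvg_cst.
  by rewrite mexpE; exact: is_cvg_pseries_mx_pow.
apply/funext => k; rewrite /pseries /series /=.
under [RHS]eq_bigr do rewrite mulr_suml.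
rewrite exchange_big/=; apply: eq_bigr => l _.
rewrite mxE mulr_sumr mulr_suml; apply: eq_bigr => r _.
by rewrite -!mulrA; congr (_ * (_ * _)); exact: mulrC.
Qed.

Lemma mexp0 : mexp (0 : 'M[R]_n) = 1%:M.
Proof.
apply: cvg_lim => //.
apply: cvg_near_cst; near=> k.
have k0 : (0 < k)%N by near: k; exists 1%N.
rewrite /series /= big_ltn// expr0 fact0 invr1 scale1r big1_seq ?addr0//.
move=> l /andP[_]; rewrite mem_index_iota => /andP[l0 _].
by rewrite expr0n gtn_eqF// scaler0.
Unshelve. all: by end_near. Qed.

Lemma comm_mexp M N : M *m N = N *m M -> mexp M *m N = N *m mexp M.
Proof.
move=> MN; set s := series (fun k => (k`!%:R)^-1 *: M ^+ k).
have cM : s @ \oo --> mexp M := @is_cvg_mexp M.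
have sN : (fun k => s k *m N) = (fun k => N *m s k).
  apply/funext => k; rewrite /s /series/= mulmx_suml mulmx_sumr.
  apply: eq_bigr => l _; rewrite -scalemxAl -scalemxAr; congr (_ *: _).
  by rewrite mulmxE; apply/esym/commrX.
have c1 : (fun k => s k *m N) @ \oo --> mexp M *m N.
  exact: (cvg_linear_mx (mulmxr N) cM).
have c2 : (fun k => N *m s k) @ \oo --> N *m mexp M.
  exact: (cvg_linear_mx (mulmx N) cM).
by rewrite sN in c1; exact: (cvg_unique _ c1 c2).
Qed.

Lemma trmx_mexp M : (mexp M)^T = mexp M^T.
Proof.
set s := series (fun k => (k`!%:R)^-1 *: M ^+ k).
have sT : (fun k => (s k)^T) = series (fun k => (k`!%:R)^-1 *: M^T ^+ k).
  apply/funext => k; rewrite /s /series/= linear_sum; apply: eq_bigr => l _ /=.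
  rewrite linearZ/=; congr (_ *: _).
  elim: l => [|l IH]; first by rewrite !expr0 trmx1.
  by rewrite exprS exprSr -!mulmxE trmx_mul IH.
have c1 : (fun k => (s k)^T) @ \oo --> (mexp M)^T.
  exact: (cvg_linear_mx trmx (@is_cvg_mexp M)).
by apply/esym/cvg_lim => //; rewrite -sT.
Qed.

Lemma comm_mexpZ M t : mexp (t *: M) *m M = M *m mexp (t *: M).
Proof. by apply: comm_mexp; rewrite -scalemxAl -scalemxAr. Qed.

Lemma is_derive_mexp M t :
  is_derive t (1 : R) (fun s => mexp (s *: M)) (mexp (t *: M) *m M).
Proof.
apply/is_derive_mxP => i j.
under eq_fun do rewrite mexpE.
have fE : (fun k => (k`!%:R)^-1 * (M ^+ k.+1) i j) =
    (fun k => (k`!%:R)^-1 * (M ^+ k *m M) i j).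
  by apply/funext => k; rewrite exprSr mulmxE.
have <- := cvg_lim (@Rhausdorff _) (@cvg_pseries_mexp_mul M M t i j).
rewrite -fE -pseries_diffs_mx_pow.
apply: (@pseries_snd_diffs _ _ (`|t| + 1)).
- exact: is_cvg_pseries_mx_pow.
- rewrite pseries_diffs_mx_pow fE; apply/cvg_ex; eexists.
  exact: cvg_pseries_mexp_mul.
- rewrite pseries_diffs_mx_pow.
  rewrite (_ : pseries_diffs _ = fun k => (k`!%:R)^-1 * (M ^+ k *m M ^+ 2) i j).
    by apply/cvg_ex; eexists; exact: cvg_pseries_mexp_mul.
  apply/funext => k; rewrite /pseries_diffs factS natrM invfM mulrA mulrA.
  by rewrite mulfV ?mul1r ?pnatr_eq0// mulmxE -exprD addn2.
by rewrite [ltRHS]ger0_norm// addrC -subr_gt0 addrK.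
Qed.

End ExponentialSeries.

(** * Linear differential equations *)

Section LinearODE.
Context {R : realType} {n : nat}.
Implicit Types (M N : 'M[R]_n) (t : R).

(** Existence of an inverse comes before any addition formula: the product has
    derivative zero because exp(tM) commutes with M. *)
Lemma mexpK M t : mexp (t *: M) *m mexp (t *: - M) = 1%:M.
Proof.
have -> : 1%:M = mexp (0 *: M) *m mexp (0 *: - M).
  by rewrite !scale0r mexp0 mul1mx.
apply: (@is_derive_0_mx_cst _ _ _ (fun s => mexp (s *: M) *m mexp (s *: - M))).
move=> s; apply: is_derive_eq.
  by apply: is_derive_mulmx; exact: is_derive_mexp.
by rewrite (comm_mexpZ (- M)) mulNmx mulmxN mulmxA subrr.
Qed.

(** exp(-tM) is an integrating factor for f' = f M. *)
Lemma linear_ode_unique (p : nat) (f : R -> 'M[R]_(p, n)) M :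
  (forall t : R, is_derive t (1 : R) f (f t *m M)) ->
  forall t, f t = f 0 *m mexp (t *: M).
Proof.
move=> f' t; have : f t *m mexp (t *: - M) = f 0 *m mexp (0 *: - M).
  apply: (@is_derive_0_mx_cst _ _ _ (fun s => f s *m mexp (s *: - M))) => s.
  apply: is_derive_eq.
    by apply: is_derive_mulmx; exact: is_derive_mexp.
  by rewrite (comm_mexpZ (- M)) mulNmx mulmxN mulmxA subrr.
rewrite scale0r mexp0 mulmx1 => <-; rewrite -mulmxA.
by have := mexpK (- M) t; rewrite opprK => ->; rewrite mulmx1.
Qed.

Lemma mexp_double M t :
  mexp (t *: (M + M)) = mexp (t *: M) *m mexp (t *: M).
Proof.
rewrite [RHS](@linear_ode_unique _ (fun s => mexp (s *: M) *m mexp (s *: M))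
  (M + M)); first by rewrite scale0r mexp0 !mul1mx.
move=> s; apply: is_derive_eq.
  by apply: is_derive_mulmx; exact: is_derive_mexp.
by rewrite mulmxDr -!mulmxA -(comm_mexpZ M).
Qed.

End LinearODE.

Section OperatorExponential.
Context {R : realType} {p q : nat} (P : {linear 'M[R]_(p, q) -> 'M[R]_(p, q)}).
Implicit Types (B : 'M[R]_(p, q)) (t : R).

(** Flattening matrices to row vectors turns a linear operator into right
    multiplication by a matrix, so exponentials of operators reduce to
    exponentials of matrices. *)
Lemma expvE t B : expv (fun B => t *: P B) B =
  vec_mx (mxvec B *m mexp (t *: lin_mx P)).
Proof.
apply: cvg_lim => //.
rewrite (_ : series _ = fun k => vec_mx (mxvec B *m
    series (fun k => (k`!%:R)^-1 *: (t *: lin_mx P) ^+ k) k)).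
  apply: (cvg_linear_mx vec_mx); apply: (cvg_linear_mx (mulmx (mxvec B))).
  exact: is_cvg_mexp.
apply/funext => k; rewrite /series /= mulmx_sumr linear_sum.
apply: eq_bigr => l _; rewrite -scalemxAr linearZ/=; congr (_ *: _).
apply: (can_inj mxvecK); rewrite vec_mxK.
elim: l => [|l IH]; first by rewrite expr0 mulmx1.
by rewrite iterS linearZ/= -mul_vec_lin IH exprSr -mulmxE mulmxA -scalemxAr.
Qed.

Lemma expv0 B : expv (fun B => 0 *: P B) B = B.
Proof. by rewrite expvE scale0r mexp0 mulmx1 mxvecK. Qed.

Lemma is_derive_expv B t : is_derive t (1 : R)
  (fun s => expv (fun B => s *: P B) B) (P (expv (fun B => t *: P B) B)).
Proof.
under eq_fun do rewrite expvE.
apply: is_derive_eq.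
  apply: (is_derive_linear_mx vec_mx).
  apply: (is_derive_linear_mx (mulmx (mxvec B))).
  exact: is_derive_mexp.
rewrite expvE; apply: (can_inj mxvecK); rewrite -[RHS]mul_vec_lin.
by rewrite /= !vec_mxK mulmxA.
Qed.

Lemma operator_ode_unique (f : R -> 'M[R]_(p, q)) :
  (forall t : R, is_derive t (1 : R) f (P (f t))) ->
  forall t, f t = expv (fun B => t *: P B) (f 0).
Proof.
move=> f' t; rewrite expvE; apply: (can_inj mxvecK); rewrite vec_mxK.
apply: (@linear_ode_unique _ _ _ (fun s => mxvec (f s))) => s.
rewrite mul_vec_lin; exact: (is_derive_linear_mx mxvec (f' s)).
Qed.

End OperatorExponential.

Section OrthogonalExponential.
Context {R : realType} {n : nat}.
Implicit Types (X Y V : 'M[R]_n) (t : R).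

Lemma mexp_skewK V t : so V -> (mexp (t *: V))^T *m mexp (t *: V) = 1%:M.
Proof.
move=> VT; rewrite trmx_mexp linearZ/= VT.
by have := mexpK (- V) t; rewrite opprK.
Qed.

(** Orthogonality only gives a determinant 1 or -1.  As exp(tV) is the square of
    exp(tV/2), its determinant is the square of such a number. *)
Lemma SO_mexp V t : so V -> SO (mexp (t *: V)).
Proof.
move=> VT; split; first exact: mexp_skewK.
have hT : so (2^-1 *: V) by rewrite /so/= linearZ/= VT scalerN.
have -> : V = 2^-1 *: V + 2^-1 *: V.
  by rewrite -scalerDl (_ : 2^-1 + 2^-1 = 1 :> R) ?scale1r//; field.
rewrite mexp_double det_mulmx -[X in X * _]det_tr -det_mulmx.
by rewrite mexp_skewK// det1.
Qed.

Lemma SO_mulmx X Y : SO X -> SO Y -> SO (X *m Y).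
Proof.
move=> [XX Xdet] [YY Ydet]; split; last by rewrite det_mulmx Xdet Ydet mulr1.
by rewrite trmx_mul mulmxA -(mulmxA Y^T) XX mulmx1.
Qed.

Lemma SO_mulmxT X : SO X -> X *m X^T = 1%:M.
Proof. by case=> /mulmx1C. Qed.

Lemma SO_invmx X : SO X -> invmx X = X^T.
Proof.
move=> [XX _]; have [_ Xu] := mulmx1_unit XX.
by rewrite -[RHS]mulmx1 -(mulmxV Xu) mulmxA XX mul1mx.
Qed.

End OrthogonalExponential.

(** * Smooth maps between matrix spaces *)

Section SmoothClosure.
Context {R : realType} {V : normedModType R}.

Lemma class_CS (W : normedModType R) k (f : V -> W) :
  class_C k.+1 f -> class_C k f.
Proof.
elim: k f => [|k IH] f /= [df Df]; last by split=> // v; exact: IH.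
by move=> x; exact: differentiable_continuous.
Qed.

Lemma class_C_cst (W : normedModType R) k (a : W) :
  class_C k (fun _ : V => a).
Proof.
elim: k a => [|k IH] a /=; first by move=> x; exact: cvg_cst.
split=> [x|v]; first exact: differentiable_cst.
rewrite [X in class_C _ X](_ : _ = fun=> 0); first exact: IH.
by apply/funext => x; exact: derive_cst.
Qed.

Lemma class_C_linear (W : normedModType R) k (L : {linear V -> W}) :
  continuous L -> class_C k L.
Proof.
move=> Lc; case: k => [|k]//=; split=> [x|v]; first exact: linear_differentiable.
rewrite [X in class_C _ X](_ : _ = fun=> L v); first exact: class_C_cst.
apply/funext => x; rewrite deriveE; first by rewrite diff_lin.
exact: linear_differentiable.
Qed.

Lemma class_CD (W : normedModType R) k (f g : V -> W) :
  class_C k f -> class_C k g -> class_C k (fun x => f x + g x).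
Proof.
elim: k f g => [|k IH] f g /=.
  by move=> fc gc x; apply: cvgD; [exact: fc|exact: gc].
move=> [df Df] [dg Dg]; split=> [x|v]; first exact: differentiableD.
rewrite [X in class_C _ X](_ : _ = fun x => 'D_v f x + 'D_v g x); first exact: IH.
by apply/funext => x; rewrite deriveD//; exact: diff_derivable.
Qed.

Lemma class_C_sum (W : normedModType R) k (I : finType) (f : I -> V -> W) :
  (forall i, class_C k (f i)) -> class_C k (fun x => \sum_i f i x).
Proof.
move=> fk; rewrite [X in class_C _ X](_ : _ = \sum_i f i); last first.
  by apply/funext => x; rewrite fct_sumE.
by elim/big_ind: _ => [|f' g' ? ?|//]; [exact: class_C_cst|exact: class_CD].
Qed.

(** Leibniz' rule costs one derivative on each factor, hence the induction uses
    that a function of class C^(k+1) is of class C^k. *)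
Lemma class_CM k (f g : V -> R^o) :
  class_C k f -> class_C k g -> class_C k (fun x => f x * g x : R^o).
Proof.
elim: k f g => [|k IH] f g.
  by move=> fc gc x; apply: cvgM; [exact: fc|exact: gc].
move=> fk gk; have [df Df] := fk; have [dg Dg] := gk.
split=> [x|v]; first exact: differentiableM.
rewrite [X in class_C _ X](_ : _ = fun x => f x * 'D_v g x + g x * 'D_v f x).
  by apply: class_CD; apply: IH; [exact: class_CS|exact: Dg|exact: class_CS|exact: Df].
by apply/funext => x; apply: deriveM; exact: diff_derivable.
Qed.

Lemma differentiable_mxP (p q : nat) (F : V -> 'M[R]_(p, q)) x :
  (forall i j, differentiable (fun y => F y i j : R^o) x) <->
  differentiable F x.
Proof.
split=> [dF|dF i j]; last first.
  exact: (differentiable_comp dF (differentiable_coord (F x) i j)).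
have -> : F = \sum_i \sum_j (fun y => F y i j *: delta_mx i j).
  apply/funext => y; rewrite [LHS]matrix_sum_delta fct_sumE.
  by apply: eq_bigr => i _; rewrite fct_sumE.
apply: differentiable_sum => i; apply: differentiable_sum => j.
exact: differentiableZl.
Qed.

(** Reduces the smoothness of every matrix expression to sums and products of
    real-valued functions. *)
Lemma class_C_mxP k (p q : nat) (F : V -> 'M[R]_(p, q)) :
  (forall i j, class_C k (fun x => F x i j : R^o)) <-> class_C k F.
Proof.
elim: k F => [|k IH] F.
  split=> [Fc x|Fc i j x]; first by apply: cvg_mx => i j; exact: Fc.
  exact: (continuous_comp (Fc x) (@coord_continuous _ _ _ i j (F x))).
have DE v i j : (forall x, differentiable F x) ->
    (fun x => 'D_v F x i j) = (fun x => 'D_v (fun y => F y i j) x).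
  move=> dF; apply/funext => x; rewrite derive_mx ?mxE//.
  exact: diff_derivable.
split=> [Fk|[dF Fk] i j].
  have dF : forall x, differentiable F x.
    by move=> x; apply/differentiable_mxP => i j; have [] := Fk i j.
  by split=> // v; apply/IH => i j; rewrite DE//; have [_ Dk] := Fk i j; exact: Dk.
split=> [x|v]; first by move/differentiable_mxP: (dF x).
by rewrite -DE//; move/IH: (Fk v).
Qed.

Lemma class_C_mulmx k (p q r : nat) (F : V -> 'M[R]_(p, q))
    (G : V -> 'M[R]_(q, r)) :
  class_C k F -> class_C k G -> class_C k (fun x => F x *m G x).
Proof.
move=> /class_C_mxP Fk /class_C_mxP Gk; apply/class_C_mxP => i j.
rewrite [X in class_C _ X](_ : _ = fun x => \sum_l F x i l * G x l j).
  by apply: class_C_sum => l; exact: class_CM.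
by apply/funext => x; rewrite mxE.
Qed.

Lemma class_C_linear_mx k (p q r s : nat)
    (L : {linear 'M[R]_(p, q) -> 'M[R]_(r, s)}) (F : V -> 'M[R]_(p, q)) :
  class_C k F -> class_C k (fun x => L (F x)).
Proof.
move=> /class_C_mxP Fk; apply/class_C_mxP => i j.
rewrite [X in class_C _ X](_ : _ =
    fun x => \sum_a \sum_b F x a b * L (delta_mx a b) i j).
  by apply: class_C_sum => a; apply: class_C_sum => b;
    apply: class_CM => //; exact: class_C_cst.
apply/funext => x; rewrite [in LHS](matrix_sum_delta (F x)) linear_sum summxE.
apply: eq_bigr => a _; rewrite linear_sum summxE; apply: eq_bigr => b _.
by rewrite linearZ mxE.
Qed.

End SmoothClosure.

Arguments class_C_linear_mx {R V k p q r s} L {F}.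
Arguments class_C_linear {R V W k} L.

(** D_Y Z is a combination of the partial derivatives of Z with the entries of Y
    as coefficients. *)
Lemma class_C_directional (R : realType) k (p q r s : nat)
    (Y : 'M[R]_(p, q) -> 'M[R]_(p, q)) (Z : 'M[R]_(p, q) -> 'M[R]_(r, s)) :
  class_C k Y -> class_C k.+1 Z -> class_C k (fun x => 'D_(Y x) Z x).
Proof.
move=> /class_C_mxP Yk [dZ Zk]; apply/class_C_mxP => i j.
rewrite [X in class_C _ X](_ : _ =
    fun x => \sum_a \sum_b Y x a b * 'D_(delta_mx a b) Z x i j).
  apply: class_C_sum => a; apply: class_C_sum => b.
  apply: class_CM => //; by have /class_C_mxP := Zk (delta_mx a b).
apply/funext => x; rewrite deriveE// [in LHS](matrix_sum_delta (Y x)).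
rewrite linear_sum summxE; apply: eq_bigr => a _.
rewrite linear_sum summxE; apply: eq_bigr => b _.
by rewrite linearZ mxE deriveE.
Qed.

(** * Calculus on SO(n) *)

Lemma is_derive_along_curve (R : realType) (V W : normedModType R)
    (F : V -> W) (c : R -> V) (t : R) (dc : V) :
  is_derive t (1 : R) c dc -> differentiable F (c t) ->
  is_derive t (1 : R) (fun s => F (c s)) ('D_dc F (c t)).
Proof.
move=> [dct <-] dF; have /derivable1_diffP dct' := dct.
apply: DeriveDef.
  by apply/derivable1_diffP; exact: (differentiable_comp dct' dF).
rewrite (@deriveE _ _ _ (fun s => F (c s))); last exact: differentiable_comp.
by rewrite (diff_comp dct' dF) !deriveE.
Qed.

Section Determinant.
Context {R : realType} {n : nat}.

Lemma continuous_det : continuous (fun A : 'M[R]_n => \det A : R^o).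
Proof.
apply: continuous_big => [|s _ A]; first exact: add_continuous.
apply: (@cvgM _ _ (nbhs A)); first exact: cvg_cst.
move: A; apply: continuous_big => [|i _ A]; first exact: mul_continuous.
exact: coord_continuous.
Qed.

End Determinant.

Section InverseDerivative.
Context {R : realType} {n : nat}.
Implicit Types (A X Y : 'M[R]_n).

Lemma near_unitmx X : X \in unitmx -> \forall A \near X, A \in unitmx.
Proof.
rewrite unitmxE unitfE => dX.
have /cvgr_neq0/(_ dX) := @continuous_det R n X.
by apply: filterS => A; rewrite unitmxE unitfE.
Qed.

(** Near X the inverse is the adjugate divided by the determinant, and both are
    polynomial in the entries. *)
Lemma continuous_invmx X : X \in unitmx -> {for X, continuous (@invmx R n)}.
Proof.
move=> Xu.
have adjc : (fun A : 'M[R]_n => (\det A)^-1 *: \adj A) @ X --> invmx X.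
  rewrite /invmx Xu; apply: (@cvgZ _ _ _ (nbhs X)).
    apply: (@cvgV _ _ (nbhs X)); last exact: continuous_det.
    by rewrite -unitfE -unitmxE.
  apply: cvg_mx => i j; under eq_cvg do rewrite mxE; rewrite mxE.
  apply: (@cvgM _ _ (nbhs X)); first exact: cvg_cst.
  have minorc : (fun A : 'M[R]_n => row' j (col' i A)) @ nbhs X -->
      row' j (col' i X).
    have h1 := cvg_linear_mx (col' i) (@cvg_id _ (nbhs X)).
    have h2 := cvg_linear_mx (row' j) h1. exact h2.
  exact: (cvg_comp _ _ minorc (@continuous_det R n.-1 _)).
apply: cvg_trans adjc; apply: (@near_eq_cvg _ _ (nbhs X)).
by have := near_unitmx Xu; apply: filterS => A Au; rewrite /invmx Au.
Qed.

(** With N the inverse at X + hY, the increment N - X^-1 equals - h N Y X^-1. *)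
Lemma is_derive_invmx X Y : X \in unitmx ->
  is_derive X Y (@invmx R n) (- (invmx X *m Y *m invmx X)).
Proof.
move=> Xu.
have cX : (fun h : R => h *: Y + X) @ nbhs 0 --> X.
  have : (fun h : R => h *: Y + X) @ nbhs 0 --> 0 *: Y + X.
    by apply: cvgD; [apply: cvgZr_tmp; exact: cvg_id|exact: cvg_cst].
  by rewrite scale0r add0r.
have cI : (fun h : R => - (invmx (h *: Y + X) *m Y *m invmx X)) @ 0^' -->
    - (invmx X *m Y *m invmx X).
  apply: cvg_within_filter; apply: cvgN.
  apply: (cvg_linear_mx (mulmxr (invmx X))); apply: (cvg_linear_mx (mulmxr Y)).
  exact: (cvg_comp _ _ cX (continuous_invmx Xu)).
have dI : (fun h => h^-1 *: ((@invmx R n \o shift X) (h *: Y) - invmx X)) @ 0^'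
    --> - (invmx X *m Y *m invmx X).
  apply: cvg_trans cI; apply: near_eq_cvg.
  have hu : \forall h \near 0^', h *: Y + X \in unitmx.
    by apply: cvg_within; exact: cX (near_unitmx Xu).
  have h0 : \forall h \near (0 : R)^', h != 0 by exact: nbhs_dnbhs_neq.
  near=> h.
  have hn0 : h != 0 by near: h.
  have hX : h *: Y + X \in unitmx by near: h.
  apply: (scalerI hn0); rewrite scalerA mulfV// scale1r/= scalerN.
  have -> : invmx (h *: Y + X) - invmx X =
      invmx (h *: Y + X) *m (X - (h *: Y + X)) *m invmx X.
    by rewrite mulmxBr mulVmx// mulmxBl mul1mx -mulmxA mulmxV// mulmx1.
  by rewrite opprD addrCA subrr addr0 mulmxN mulNmx -scalemxAr -scalemxAl.
apply: DeriveDef; first by apply/cvg_ex; eexists; exact: dI.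
exact: cvg_lim dI.
Unshelve. all: by end_near. Qed.

End InverseDerivative.

Section Geometry.
Context {R : realType} {n : nat}.
Local Notation M := 'M[R]_n.
Implicit Types (X V : M).

Lemma is_derive_SO_curve X V :
  is_derive (0 : R) (1 : R) (fun s => X *m mexp (s *: V)) (X *m V).
Proof.
apply: is_derive_eq.
  exact: (is_derive_linear_mx (mulmx X) (is_derive_mexp V 0)).
by rewrite scale0r mexp0 /= mul1mx.
Qed.

(** Both derivatives are velocities of the same curve, the image of
    s |-> X exp(sV), which stays in SO(n).  This is what makes extensions of
    fields to the whole matrix space harmless. *)
Lemma eq_derive_SO (W : normedModType R) (F G : M -> W) X V :
  differentiable F X -> differentiable G X ->
  (forall Y, SO Y -> F Y = G Y) -> SO X -> so V ->
  'D_(X *m V) F X = 'D_(X *m V) G X.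
Proof.
move=> dF dG FG SX sV.
have cX : X *m mexp (0 *: V) = X by rewrite scale0r mexp0 mulmx1.
rewrite -cX in dF dG.
have [_ eF] := is_derive_along_curve (is_derive_SO_curve X V) dF.
have [_ eG] := is_derive_along_curve (is_derive_SO_curve X V) dG.
rewrite cX in eF eG; rewrite -eF -eG; congr (derive _ _ _).
apply/funext => s.
by rewrite FG//; apply: SO_mulmx => //; exact: SO_mexp.
Qed.

Lemma smooth_differentiable (W W' : normedModType R) (f : W -> W') x :
  smooth f -> differentiable f x.
Proof. by move=> /(_ 1%N)[]. Qed.

Lemma tangent_SOP X (Y : M) : SO X -> tangent_SO X Y <-> so (X^T *m Y).
Proof.
move=> SX; split=> [[V sV <-]|sV]; first by rewrite mulmxA SX.1 mul1mx.
by exists (X^T *m Y) => //; rewrite mulmxA SO_mulmxT// mul1mx.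
Qed.

(** Left-invariant fields realise every tangent vector at every point; they are
    the test fields in all pointwise arguments. *)
Lemma vector_field_left V : so V -> vector_field (fun X => X *m V).
Proof.
move=> sV; split=> [k|X _]; last by exists V.
exact: (class_C_linear (mulmxr V) (continuous_linear_mx _)).
Qed.

(** Up to a tangent vector, D_{XV} Z is X V (X^T Z): differentiate the identity
    X^T Z + Z^T X = 0, valid on SO(n), in the direction X V. *)
Lemma so_derive_field (Z : M -> M) X V : vector_field Z -> SO X -> so V ->
  so (X^T *m 'D_(X *m V) Z X - V *m (X^T *m Z X)).
Proof.
move=> [sZ tZ] SX sV.
pose H (x : M) := x^T *m Z x.
have sH : smooth H.
  move=> k; apply: class_C_mulmx; last exact: sZ.
  exact: (class_C_linear trmx (continuous_linear_mx _)).
have dH : is_derive X (X *m V) H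
    ((X *m V)^T *m Z X + X^T *m 'D_(X *m V) Z X).
  apply: is_derive_mulmx.
    exact: (is_derive_linear_mx trmx (is_derive_id _ _)).
  by apply: derivableP; apply: diff_derivable; exact: smooth_differentiable.
have dHT := is_derive_linear_mx trmx dH.
have dF : differentiable (fun x => H x + (H x)^T) X.
  apply: smooth_differentiable => k; apply: class_CD; first exact: sH.
  by apply: (class_C_linear_mx trmx); exact: sH.
have H0 Y : SO Y -> H Y + (H Y)^T = 0.
  by move=> SY; rewrite /H ((tangent_SOP _ SY).1 (tZ Y SY)) subrr.
have := eq_derive_SO dF (differentiable_cst 0 X) H0 SX sV.
rewrite derive_cst; have [_ ->] := is_deriveD dH dHT.
rewrite trmx_mul sV !mulNmx -mulmxA addrC [- _ + _]addrC => D0.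
by rewrite /so/=; apply/eqP; rewrite -addr_eq0; apply/eqP.
Qed.

End Geometry.

(** * The projection onto a and the bilinear form *)

Section MatrixIdentities.
Context {R : realType} {p q : nat}.
Implicit Types A B : 'M[R]_(p, q).

Lemma entry0 i j : (0 : 'M[R]_(p, q)) i j = 0.
Proof. by rewrite mxE. Qed.

Lemma entryD A B i j : (A + B) i j = A i j + B i j.
Proof. by rewrite mxE. Qed.

Lemma entryN A i j : (- A) i j = - A i j.
Proof. by rewrite mxE. Qed.

Lemma entryZ (a : R) A i j : (a *: A) i j = a * A i j.
Proof. by rewrite mxE. Qed.

End MatrixIdentities.

Ltac mx_expand := rewrite ?(mulmxDl, mulmxDr, mulNmx, mulmxN,
  scalerDr, scalerN) -?(scalemxAl, scalemxAr) ?mulmxA ?scalerDr ?scalerN.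

(* Identities that are linear in noncommutative monomials: expand into monomials
   and compare entry by entry. *)
Ltac mx_field := rewrite /commutator_mx;
  do ?[progress mx_expand];
  apply/matrixP => ? ?; rewrite ?(entry0, entryD, entryN, entryZ); field.

Section Commutators.
Context {R : realType} {n : nat}.
Implicit Types A B C V : 'M[R]_n.

Lemma so_commutator A B : so A -> so B -> so (commutator_mx A B).
Proof.
move=> sA sB; rewrite /so/= /commutator_mx opprB [LHS]linearB/= !trmx_mul sA sB.
by rewrite !mulNmx !mulmxN !opprK.
Qed.

Lemma soD A B : so A -> so B -> so (A + B).
Proof. by move=> sA sB; rewrite /so/= linearD/= sA sB opprD. Qed.

Lemma soZ a A : so A -> so (a *: A).
Proof. by move=> sA; rewrite /so/= linearZ/= sA scalerN. Qed.

Lemma soN A : so A -> so (- A).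
Proof. by move=> sA; rewrite /so/= linearN/= sA. Qed.

Lemma so_conj A B : so B -> so (A *m B *m A^T).
Proof. by move=> sB; rewrite /so/= !trmx_mul trmxK sB mulNmx mulmxN mulmxA. Qed.

Lemma trace_commutatorC A B C :
  \tr (commutator_mx B A *m C) = - \tr (commutator_mx A B *m C).
Proof. by rewrite -linearN/= -mulNmx /commutator_mx opprB. Qed.

Lemma trace_commutator_cyc A B C :
  \tr (commutator_mx A B *m C) = \tr (commutator_mx B C *m A).
Proof.
rewrite /commutator_mx !mulmxBl !linearB/= -[A *m B *m C]mulmxA mxtrace_mulC.
by congr (_ - _); rewrite [RHS]mxtrace_mulC mulmxA mxtrace_mulC mulmxA.
Qed.

Lemma so_trace_sqr_eq0 A : so A -> \tr (A *m A) = 0 -> A = 0.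
Proof.
move=> sA trA; have A0 : \sum_i \sum_j A i j ^+ 2 = 0.
  transitivity (- \tr (A *m A)); last by rewrite trA oppr0.
  rewrite -linearN/= -mulmxN -sA; apply: eq_bigr => i _.
  by rewrite mxE; apply: eq_bigr => j _; rewrite mxE -expr2.
have row0 i : \sum_j A i j ^+ 2 = 0.
  apply: (psumr_eq0P _ A0) => // l _; apply: sumr_ge0 => j _; exact: sqr_ge0.
apply/matrixP => i j; rewrite mxE; apply/eqP; rewrite -sqrf_eq0; apply/eqP.
by apply: (psumr_eq0P _ (row0 i)) => // l _; exact: sqr_ge0.
Qed.

End Commutators.

Section Projection.
Context {R : realType} {d m : nat}.
Local Notation M := 'M[R]_(d + m).
Implicit Types A B V Q : M.

Definition idblock : M := block_mx 1%:M 0 0 0.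

Lemma trmx_idblock : idblock^T = idblock.
Proof. by rewrite /idblock tr_block_mx trmx1 !trmx0. Qed.

Lemma idblockK : idblock *m idblock = idblock.
Proof. by rewrite /idblock mulmx_block !(mulmx0, mul0mx, addr0, mulmx1). Qed.

(** Compression by the block projector J turns all properties of P into
    identities about products with J. *)
Lemma proj_aE V : proj_a V = 2^-1 *: (idblock *m (V - V^T) *m idblock).
Proof.
rewrite /proj_a /idblock -{3 4}(submxK V) tr_block_mx opp_block_mx add_block_mx.
rewrite !mulmx_block !(mulmx0, mul0mx, addr0, mulmx1, mul1mx).
by rewrite scale_block_mx !scaler0.
Qed.

Fact proj_a_is_linear : linear (@proj_a R d m).
Proof. by move=> a A B; rewrite !proj_aE !linearD/= !linearZ/=; mx_field. Qed.

HB.instance Definition _ := GRing.isLinear.Build R M M _ _ proj_a_is_linear.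

Lemma so_proj_a V : so (proj_a V).
Proof.
rewrite /so/= !proj_aE linearZ/= !trmx_mul trmx_idblock !linearB/= trmxK.
by mx_field.
Qed.

Lemma proj_a_trmx V : proj_a V^T = - proj_a V.
Proof. by rewrite !proj_aE trmxK; mx_field. Qed.

Lemma proj_a_so V : so V -> proj_a V = idblock *m V *m idblock.
Proof. by move=> sV; rewrite proj_aE sV; mx_field. Qed.

Lemma proj_a_idem V : proj_a (proj_a V) = proj_a V.
Proof.
rewrite (proj_a_so (so_proj_a _)) proj_aE -scalemxAr -scalemxAl !mulmxA idblockK.
by rewrite -!mulmxA idblockK.
Qed.

Lemma proj_aJ V : proj_a V *m idblock = proj_a V.
Proof. by rewrite proj_aE -scalemxAl -mulmxA idblockK. Qed.

Lemma Jproj_a V : idblock *m proj_a V = proj_a V.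
Proof. by rewrite proj_aE -scalemxAr !mulmxA idblockK. Qed.

(** P is an antisymmetrization followed by a compression by J, and both are
    self-adjoint for the trace form. *)
Lemma trace_proj_a A B : \tr (proj_a A *m B) = \tr (A *m proj_a B).
Proof.
have trJ C D : \tr (idblock *m C *m idblock *m D) =
    \tr (C *m (idblock *m D *m idblock)).
  by rewrite -!mulmxA mxtrace_mulC !mulmxA.
rewrite !proj_aE -scalemxAl -scalemxAr !linearZ/= trJ; congr (_ * _).
rewrite !(mulmxBl, mulmxBr) !linearB/=; congr (_ - _).
rewrite -[LHS]mxtrace_tr !trmx_mul trmx_idblock trmxK mxtrace_mulC.
by rewrite !mulmxA.
Qed.

(** The pair (so(n), a) is reductive: the complement of a is stable under
    brackets with a, so P commutes with ad of elements of a. *)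
Lemma proj_a_commutator A B : so B ->
  proj_a (commutator_mx (proj_a A) B) = commutator_mx (proj_a A) (proj_a B).
Proof.
move=> sB; rewrite proj_a_so; last first.
  by apply: so_commutator => //; exact: so_proj_a.
rewrite (proj_a_so sB) /commutator_mx mulmxBr mulmxBl; congr (_ - _).
  by rewrite !mulmxA Jproj_a proj_aJ.
by rewrite -!mulmxA proj_aJ Jproj_a.
Qed.

Lemma proj_a_conj Q V : Q *m idblock = idblock *m Q ->
  proj_a (Q *m V *m Q^T) = Q *m proj_a V *m Q^T.
Proof.
move=> QJ; have JQ : idblock *m Q^T = Q^T *m idblock.
  by rewrite -trmx_idblock -!trmx_mul QJ.
rewrite !proj_aE !trmx_mul trmxK -scalemxAr -scalemxAl; congr (_ *: _).
have -> : Q *m V *m Q^T - Q *m (V^T *m Q^T) = Q *m (V - V^T) *m Q^T.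
  by rewrite mulmxBr mulmxBl mulmxA.
by rewrite !mulmxA -QJ -!mulmxA JQ.
Qed.

End Projection.

(** With t(u, v, w) = tr([u, v] w), cyclic and alternating, the metric
    compatibility of the connection is this cancellation; it rests on the rule
    that an argument between two values of p may be projected.  The form t is
    left abstract to keep the cancellation inside R. *)
Lemma left_connection_trilinear (R : realType) (T : Type) (S : T -> Prop) (p : T -> T)
    (t : T -> T -> T -> R) (k : R) (V A B : T) :
  (forall U V W, t U V W = t V W U) ->
  (forall U V W, t U W V = - t U V W) ->
  (forall U V W, S V -> t (p U) V (p W) = t (p U) (p V) (p W)) ->
  S V -> S A -> S B ->
  - 2^-1 * (2^-1 * t V A B + k / 2 * (t (p V) A B + t (p A) V B)) +
  k / 2 * (2^-1 * t V A (p B) + k / 2 * (t (p V) A (p B) + t (p A) V (p B))) +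
  (- 2^-1 * (2^-1 * t V B A + k / 2 * (t (p V) B A + t (p B) V A)) +
  k / 2 * (2^-1 * t V B (p A) + k / 2 * (t (p V) B (p A) + t (p B) V (p A))))
  = 0.
Proof.
move=> tcyc tN tp SV SA SB.
rewrite (tp V A)// (tp A V)// (tp V B)// (tp B V)//.
rewrite (tN V A B) (tN (p V) A B) (tcyc (p A) V) (tcyc (p B) V).
rewrite (tcyc (p A) (p V)) (tcyc (p B) (p V)) (tN _ (p A) (p B)).
by field.
Qed.

Section Form.
Context {R : realType} {d m : nat} (alpha : R).
Local Notation M := 'M[R]_(d + m).
Local Notation k := (1 - 2 * alpha).
Local Notation b := (@form_beta R d m (- 2^-1) alpha).
Implicit Types A B V : M.

Lemma form_betaE A B :
  b A B = - 2^-1 * \tr (A *m B) + k / 2 * \tr (A *m proj_a B).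
Proof.
by rewrite /form_beta trace_proj_a proj_a_idem; field.
Qed.

Lemma form_betaC A B : b A B = b B A.
Proof. by rewrite /form_beta mxtrace_mulC [\tr (proj_a A *m _)]mxtrace_mulC. Qed.

Lemma trace_mul_comb (a c : R) (X Y Z W : M) :
  \tr ((a *: X + c *: (Y + Z)) *m W) =
  a * \tr (X *m W) + c * (\tr (Y *m W) + \tr (Z *m W)).
Proof.
by rewrite mulmxDl -!scalemxAl mulmxDl linearD/= !linearZ/= linearD.
Qed.

Lemma form_beta_pairE X Y A B : b X B + b A Y =
  - 2^-1 * \tr (X *m B) + k / 2 * \tr (X *m proj_a B) +
  (- 2^-1 * \tr (Y *m A) + k / 2 * \tr (Y *m proj_a A)).
Proof. by rewrite (form_betaC A) !form_betaE. Qed.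

(** The covariant derivative of the left-invariant field XA along the
    left-invariant field XV is X times this matrix. *)
Definition left_connection V A : M := 2^-1 *: commutator_mx V A
  + (k / 2) *: (commutator_mx (proj_a V) A + commutator_mx (proj_a A) V).

(** Metric compatibility on left-invariant fields, whose inner products are
    constant. *)
Lemma left_connection_skew V A B : so V -> so A -> so B ->
  b (left_connection V A) B + b A (left_connection V B) = 0.
Proof.
move=> sV sA sB.
rewrite form_beta_pairE /left_connection.
rewrite !trace_mul_comb.
apply: (@left_connection_trilinear R M (@so R _) (@proj_a R d m)
  (fun U V W => \tr (commutator_mx U V *m W))) => // U V' W.
- exact: trace_commutator_cyc.
- rewrite trace_commutator_cyc [X in _ = - X]trace_commutator_cyc.
  exact: trace_commutatorC.
- move=> sV'; rewrite -[in LHS](proj_a_idem W) -trace_proj_a.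
  by rewrite proj_a_commutator.
Qed.

(** The restriction of the form to a is proportional to alpha, and on the
    complement of a it is definite. *)
Lemma form_beta_nondeg A : alpha != 0 -> so A ->
  (forall B, so B -> b A B = 0) -> A = 0.
Proof.
move=> a0 sA bA.
(* b A is B |-> - tr (C B) / 2, so C is orthogonal to itself for the trace. *)
pose C := A - k *: proj_a A.
have sC : so C by apply: soD => //; apply: soN; apply: soZ; exact: so_proj_a.
have C0 : C = 0.
  apply: so_trace_sqr_eq0 => //; have := bA C sC.
  rewrite form_betaE -trace_proj_a.
  have -> : \tr (C *m C) = \tr (A *m C) - k * \tr (proj_a A *m C).
    by rewrite {1}/C mulmxBl -scalemxAl linearB/= linearZ.
  move: (\tr (A *m C)) (\tr (proj_a A *m C)) => x y xy.
  have -> : x - k * y = - 2 * (- 2^-1 * x + k / 2 * y) by field.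
  by rewrite xy mulr0.
have PA0 : (2 * alpha) *: proj_a A = 0.
  have : proj_a C = 0 by rewrite C0 linear0.
  rewrite /C linearB/= linearZ/= proj_a_idem -{1}[proj_a A]scale1r -scalerBl.
  by rewrite opprB addrCA subrr addr0.
move: PA0 => /eqP; rewrite scaler_eq0 mulf_eq0 pnatr_eq0/= (negPf a0)/= => /eqP PA0.
by move: C0; rewrite /C PA0 scaler0 subr0.
Qed.

End Form.

(** * The connection D + Gamma *)

Section LeviCivita.
Context {R : realType} {d m : nat} (alpha : R).
Local Notation M := 'M[R]_(d + m).
Local Notation k := (1 - 2 * alpha).
Local Notation b := (@form_beta R d m (- 2^-1) alpha).
Implicit Types (X V xi eta : M) (Y Z W : M -> M).

Definition christoffel_formula X xi eta : M :=
  2^-1 *: (X *m (xi^T *m eta + eta^T *m xi))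
  + (k / 2) *: (X *m (commutator_mx (proj_a (X^T *m xi)) (X^T *m eta)
                      + commutator_mx (proj_a (X^T *m eta)) (X^T *m xi))).

Definition metric_connection Y Z X : M :=
  'D_(Y X) Z X + christoffel_formula X (Y X) (Z X).

Lemma christoffel_formulaC X xi eta :
  christoffel_formula X xi eta = christoffel_formula X eta xi.
Proof.
rewrite /christoffel_formula (addrC (xi^T *m eta)).
move: (commutator_mx (proj_a (X^T *m xi)) _) => p.
by move: (commutator_mx (proj_a (X^T *m eta)) _) => q; rewrite (addrC p).
Qed.

Lemma christoffel_formula_linear X (a : R) xi xi' eta :
  christoffel_formula X (a *: xi + xi') eta =
  a *: christoffel_formula X xi eta + christoffel_formula X xi' eta.
Proof.
have eT : (a *: xi + xi')^T = a *: xi^T + xi'^T by rewrite linearP.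
have eX : X^T *m (a *: xi + xi') = a *: (X^T *m xi) + X^T *m xi'.
  by rewrite linearP.
have eP (U U' : M) : proj_a (a *: U + U') = a *: proj_a U + proj_a U'.
  by rewrite linearP.
rewrite /christoffel_formula eT eX eP.
move: (X^T *m xi) (X^T *m xi') (X^T *m eta) => u u' w.
by move: (proj_a u) (proj_a u') (proj_a w) => p p' r; mx_field.
Qed.

(** In the left trivialization the derivative of the left-invariant field XA in
    the direction XV is X(VA); the formula for Gamma corrects it to the value of
    [left_connection]. *)
Lemma christoffel_formulaE X V A : SO X -> so V -> so A ->
  christoffel_formula X (X *m V) (X *m A) = X *m (left_connection alpha V A - V *m A).
Proof.
move=> [XX _] sV sA; rewrite /christoffel_formula !trmx_mul.
rewrite !mulmxA -[V^T *m _ *m X]mulmxA -[A^T *m _ *m X]mulmxA XX !mulmx1 !mul1mx.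
rewrite sV sA /left_connection; move: (proj_a V) (proj_a A) => pV pA.
by mx_field.
Qed.

Lemma so_left_connection V A : so V -> so A -> so (left_connection alpha V A).
Proof.
by move=> sV sA; apply: soD; apply: soZ; [|apply: soD]; apply: so_commutator => //;
  exact: so_proj_a.
Qed.

(** Both summands on the right are antisymmetric, the second by
    [so_derive_field]; this is how tangency is seen. *)
Lemma metric_connectionE Y Z X : vector_field Y -> vector_field Z -> SO X ->
  X^T *m metric_connection Y Z X = left_connection alpha (X^T *m Y X) (X^T *m Z X)
    + (X^T *m 'D_(Y X) Z X - (X^T *m Y X) *m (X^T *m Z X)).
Proof.
move=> [_ tY] [_ tZ] SX; have [V sV VE] := tY X SX; have [A sA AE] := tZ X SX.
have XK U : X^T *m (X *m U) = U by rewrite mulmxA SX.1 mul1mx.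
rewrite /metric_connection -VE -AE christoffel_formulaE// mulmxDr !XK.
by rewrite addrCA.
Qed.

Lemma smooth_metric_connection Y Z :
  smooth Y -> smooth Z -> smooth (metric_connection Y Z).
Proof.
move=> sY sZ j; apply: class_CD; first by apply: class_C_directional.
have sT (F : M -> M) i : class_C i F -> class_C i (fun x => (F x)^T).
  exact: (class_C_linear_mx trmx).
have sP (F : M -> M) i : class_C i F -> class_C i (fun x => proj_a (F x)).
  exact: (class_C_linear_mx (@proj_a R d m)).
have sI i : class_C i (fun x : M => x).
  exact: (class_C_linear (idfun : {linear M -> M}) (continuous_linear_mx _)).
have sS (c : R) (F : M -> M) i : class_C i F -> class_C i (fun x => c *: F x).
  exact: (class_C_linear_mx ( *:%R c)).
have sN (F : M -> M) i : class_C i F -> class_C i (fun x => - F x).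
  exact: (class_C_linear_mx ( -%R)).
rewrite /christoffel_formula /commutator_mx.
by do ![apply: class_CD | apply: sS | apply: class_C_mulmx | apply: sN
  | apply: sP | apply: sI | apply: sT | exact: sY | exact: sZ].
Qed.

End LeviCivita.

(** * The Levi-Civita connection *)

Lemma is_derive_scale_mx (R : realType) (V : normedModType R) (p q : nat)
    (f : V -> R^o) (F : V -> 'M[R]_(p, q)) (x v : V) (df : R)
    (dF : 'M[R]_(p, q)) :
  is_derive x v f df -> is_derive x v F dF ->
  is_derive x v (fun y => f y *: F y) (df *: F x + f x *: dF).
Proof.
move=> fx /is_derive_mxP Fx; apply/is_derive_mxP => i j.
under eq_fun do rewrite mxE.
move/is_derive_eq: (is_deriveM fx (Fx i j)); apply.
by rewrite !mxE addrC /GRing.scale/=; congr (_ + _); exact: mulrC.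
Qed.

Section LeviCivita.
Context {R : realType} {d m : nat} (alpha : R).
Local Notation M := 'M[R]_(d + m).
Local Notation b := (@form_beta R d m (- 2^-1) alpha).
Local Notation g := (@left_invariant_metric R (d + m) b).
Implicit Types (X V xi eta : M) (Y Z W : M -> M).

Lemma form_betaB A A' B : b (A - A') B = b A B - b A' B.
Proof.
rewrite !form_betaE !mulmxBl !linearB/=.
move: (\tr _) (\tr _) (\tr _) (\tr _) => x y z t; ring.
Qed.

Lemma form_betaDl A A' B : b (A + A') B = b A B + b A' B.
Proof.
rewrite !form_betaE !mulmxDl !linearD/=.
move: (\tr _) (\tr _) (\tr _) (\tr _) => x y z t; ring.
Qed.

Lemma form_betaDr A B B' : b A (B + B') = b A B + b A B'.
Proof. by rewrite form_betaC form_betaDl !(form_betaC _ A). Qed.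

(** K and K' stand for the values of [left_connection], dz and dw for the
    derivatives of the trivialized fields: the antisymmetric part K cancels. *)
Lemma form_beta_skew_shift (K K' z w p q dz dw : M) :
  b K w + b z K' = 0 -> p = K + dz -> q = K' + dw ->
  b dz w + b z dw = b p w + b z q.
Proof.
have shift (x y s t : R) : x + y = 0 -> s + t = x + s + (y + t).
  by move=> xy; rewrite addrACA xy add0r.
move=> K0 -> ->; rewrite (form_betaDl K dz w) (form_betaDr z K' dw).
exact: shift K0.
Qed.

Lemma is_derive_field Z X V : smooth Z -> is_derive X V Z ('D_V Z X).
Proof.
by move=> sZ; apply: derivableP; apply: diff_derivable; exact: smooth_differentiable.
Qed.

(** The metric differentiates X^-1 Z and not Z; the correction - V X^T Z comes
    from the derivative of the inverse. *)
Lemma is_derive_trivialized Z X V : smooth Z -> SO X ->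
  is_derive X (X *m V) (fun x => invmx x *m Z x)
    (X^T *m 'D_(X *m V) Z X - V *m (X^T *m Z X)).
Proof.
move=> sZ SX; have [_ Xu] := mulmx1_unit SX.1.
apply: is_derive_eq.
  apply: is_derive_mulmx; last exact: is_derive_field.
  exact: is_derive_invmx.
have XXV : X^T *m (X *m V) = V by rewrite mulmxA SX.1 mul1mx.
by rewrite (SO_invmx SX) XXV mulNmx -mulmxA addrC.
Qed.

Lemma is_derive_form_beta (F G : M -> M) X V dF dG :
  is_derive X V F dF -> is_derive X V G dG ->
  is_derive X V ((fun x => b (F x) (G x)) : M -> R^o) (b dF (G X) + b (F X) dG).
Proof.
move=> dFX dGX.
have dt := is_derive_linear_mx mxtrace (is_derive_mulmx dFX dGX).
have dPt := is_derive_linear_mx mxtrace (is_derive_mulmx dFX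
  (is_derive_linear_mx (@proj_a R d m) dGX)).
under eq_fun do rewrite form_betaE.
have := is_deriveD (is_deriveZ (- 2^-1) dt) (is_deriveZ ((1 - 2 * alpha) / 2) dPt).
move/is_derive_eq; apply.
rewrite !form_betaE !linearD/= /GRing.scale/=.
move: (\tr _) (\tr _) (\tr _) (\tr _) => x y z t; ring.
Qed.

Lemma metric_compatible_metric_connection : metric_compatible g (metric_connection alpha).
Proof.
move=> Y Z W fY fZ fW X SX; have [_ tY] := fY; have [V sV VE] := tY X SX.
have [sZ tZ] := fZ; have [sW tW] := fW.
have dg : is_derive X (X *m V) ((fun x => g x (Z x) (W x)) : M -> R^o) _ :=
  is_derive_form_beta (is_derive_trivialized V sZ SX)
                      (is_derive_trivialized V sW SX).
have [_ dgE] := dg.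
rewrite -{1}VE dgE /left_invariant_metric (SO_invmx SX).
have XY : X^T *m Y X = V by rewrite -VE mulmxA SX.1 mul1mx.
have sz : so (X^T *m Z X) by exact: (tangent_SOP _ SX).1 (tZ X SX).
have sw : so (X^T *m W X) by exact: (tangent_SOP _ SX).1 (tW X SX).
apply: (form_beta_skew_shift (left_connection_skew alpha sV sz sw)).
  by rewrite (metric_connectionE _ fY fZ SX) XY -VE.
by rewrite (metric_connectionE _ fY fW SX) XY -VE.
Qed.

Lemma levi_civita_metric_connection : levi_civita g (metric_connection alpha).
Proof.
split; last exact: metric_compatible_metric_connection.
- split.
  + move=> Y Z fY fZ; split.
      by apply: smooth_metric_connection; [case: fY|case: fZ].
    move=> X SX; apply/(tangent_SOP _ SX).
    rewrite metric_connectionE//; have [V sV VE] := fY.2 X SX.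
    have XY : X^T *m Y X = V by rewrite -VE mulmxA SX.1 mul1mx.
    apply: soD; last by rewrite XY -VE; exact: so_derive_field.
    by apply: so_left_connection; apply/(tangent_SOP _ SX); [exact: fY.2|exact: fZ.2].
  + move=> Y Y' Z Z' fY fY' fZ fZ' YY' ZZ' X XSO; have SX := set_mem XSO.
    rewrite /metric_connection -(YY' X XSO) -(ZZ' X XSO).
    congr (_ + christoffel_formula alpha X (Y X) (Z X)).
    have [V sV <-] := fY.2 X SX.
    apply: eq_derive_SO => //.
    * by apply: smooth_differentiable; case: fZ.
    * by apply: smooth_differentiable; case: fZ'.
    * by move=> x Sx; apply: ZZ'; exact: mem_set.
  + move=> f Y Y' Z sf fY fY' fZ X SX.
    have dZ : differentiable Z X by apply: smooth_differentiable; case: fZ.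
    rewrite /metric_connection.
    have -> : 'D_(f X *: Y X + Y' X) Z X = f X *: 'D_(Y X) Z X + 'D_(Y' X) Z X.
      by rewrite !deriveE// linearP.
    have shift (c : R) (p q r s : M) :
        c *: p + q + (c *: r + s) = c *: (p + r) + (q + s).
      by rewrite scalerDr addrACA.
    by rewrite christoffel_formula_linear; exact: shift.
  + move=> f Y Z Z' sf fY fZ fZ' X SX.
    have df : is_derive X (Y X) f ('D_(Y X) f X).
      by apply: derivableP; apply: diff_derivable; exact: smooth_differentiable.
    have dZ := is_derive_field X (Y X) fZ.1.
    have dZ' := is_derive_field X (Y X) fZ'.1.
    have [_ DE] := is_deriveD (is_derive_scale_mx df dZ) dZ'.
    have shift (c e : R) (p q r s t : M) : e *: p + c *: q + r + (c *: s + t) =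
        e *: p + c *: (q + s) + (r + t).
      by rewrite scalerDr !addrA [_ + r + _]addrAC.
    rewrite /metric_connection DE christoffel_formulaC christoffel_formula_linear.
    rewrite (christoffel_formulaC _ _ (Z X)) (christoffel_formulaC _ _ (Z' X)).
    exact: shift.
- move=> Y Z fY fZ X SX; rewrite /metric_connection christoffel_formulaC.
  by rewrite opprD addrACA subrr addr0.
Qed.

(** The difference S of two Levi-Civita connections is symmetric in its two
    arguments, and g(S(Y,Z), W) is antisymmetric in Z and W.  Six alternate
    exchanges send g(S(Y,Z), W) to its opposite, so it vanishes for all W, and
    the form is nondegenerate. *)
Lemma levi_civita_unique nabla nabla' : alpha != 0 ->
  levi_civita g nabla -> levi_civita g nabla' ->
  forall Y Z X, vector_field Y -> vector_field Z -> SO X ->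
  nabla Y Z X = nabla' Y Z X.
Proof.
move=> a0 [cn tn mn] [cn' tn' mn'] Y Z X fY fZ SX.
pose S Y Z := X^T *m (nabla Y Z X - nabla' Y Z X).
have sS Y' Z' : vector_field Y' -> vector_field Z' -> so (S Y' Z').
  move=> fY' fZ'; rewrite /S mulmxBr.
  by apply: soD; [|apply: soN]; apply/(tangent_SOP _ SX);
    [exact: (connection_field cn fY' fZ').2|
     exact: (connection_field cn' fY' fZ').2].
have SC Y' Z' : vector_field Y' -> vector_field Z' -> S Y' Z' = S Z' Y'.
  move=> fY' fZ'; rewrite /S; congr (_ *m _).
  have swap (p q r s : M) : p - q = r - s -> p - r = q - s.
    move=> /eqP; rewrite subr_eq => /eqP ->.
    by rewrite addrAC [r - s]addrC addrK addrC.
  exact/swap/(etrans (tn _ _ fY' fZ' X SX) (esym (tn' _ _ fY' fZ' X SX))).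
have skew (p p' q q' z w : M) : b p w + b z q = b p' w + b z q' ->
    b (p - p') w = - b (q - q') z.
  rewrite !form_betaB (form_betaC _ q) (form_betaC _ q').
  move: (b p w) (b z q) (b p' w) (b z q') => x y x' y' /eqP.
  by rewrite eq_sym -subr_eq => /eqP <-; ring.
have Sg Y' Z' W' : vector_field Y' -> vector_field Z' -> vector_field W' ->
    b (S Y' Z') (X^T *m W' X) = - b (S Y' W') (X^T *m Z' X).
  move=> fY' fZ' fW'; rewrite /S !mulmxBr; apply: skew; rewrite -(SO_invmx SX).
  exact: etrans (esym (mn _ _ _ fY' fZ' fW' X SX)) (mn' _ _ _ fY' fZ' fW' X SX).
suff S0 : S Y Z = 0.
  apply/eqP; rewrite -subr_eq0 -[X in X == _]mul1mx -(SO_mulmxT SX) -mulmxA.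
  by rewrite -/(S Y Z) S0 mulmx0.
apply: (form_beta_nondeg a0 (sS _ _ fY fZ)) => V sV.
have fV := vector_field_left sV.
have -> : V = X^T *m (X *m V) by rewrite mulmxA SX.1 mul1mx.
have e1 : b (S Y Z) (X^T *m (X *m V)) = - b (S Y Z) (X^T *m (X *m V)).
  rewrite {1}(Sg _ _ _ fY fZ fV) (SC _ _ fY fV) (Sg _ _ _ fV fY fZ) opprK.
  rewrite (SC _ _ fV fZ) (Sg _ _ _ fZ fV fY) (SC _ _ fZ fY).
  by [].
move: e1; move: (b _ _) => x /eqP; rewrite -subr_eq0 opprK -mulr2n mulrn_eq0/=.
by move/eqP.
Qed.

End LeviCivita.

(** * Geodesics and parallel transport *)

Lemma christoffel_unique (R : realType) (d m : nat) (alpha : R)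
    (nabla : ('M[R]_(d + m) -> 'M[R]_(d + m)) ->
      ('M[R]_(d + m) -> 'M[R]_(d + m)) -> 'M[R]_(d + m) -> 'M[R]_(d + m))
    (Gam : 'M[R]_(d + m) -> 'M[R]_(d + m) -> 'M[R]_(d + m) -> 'M[R]_(d + m))
    (X V A : 'M[R]_(d + m)) : alpha != 0 ->
  levi_civita (left_invariant_metric (form_beta (- 2^-1) alpha)) nabla ->
  christoffel_function nabla Gam -> SO X -> so V -> so A ->
  Gam X (X *m V) (X *m A) = christoffel_formula alpha X (X *m V) (X *m A).
Proof.
move=> a0 LC GamE SX sV sA.
have fV := vector_field_left sV; have fA := vector_field_left sA.
have := GamE _ _ fV fA X SX.
rewrite (levi_civita_unique a0 LC (levi_civita_metric_connection alpha) fV fA SX).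
by rewrite /metric_connection => /addrI.
Qed.

Section TransportOperator.
Context {R : realType} {d m : nat} (alpha : R).
Local Notation M := 'M[R]_(d + m).
Local Notation k := (1 - 2 * alpha).
Implicit Types V B Q : M.

Fact transport_op_is_linear V : linear (@transport_op R d m alpha V).
Proof.
move=> a A B; rewrite /transport_op linearP/=.
move: (proj_a V) (proj_a A) (proj_a B) => pV pA pB; by mx_field.
Qed.

HB.instance Definition _ V :=
  GRing.isLinear.Build R M M _ _ (transport_op_is_linear V).

Lemma trmx_transport_op V B : so V ->
  (transport_op alpha V B)^T = transport_op alpha V B^T.
Proof.
move=> sV; rewrite /transport_op proj_a_trmx.
have comT (A C : M) : (commutator_mx A C)^T = commutator_mx C^T A^T.
  by rewrite /commutator_mx linearB/= !trmx_mul.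
have trL (A C E : M) : (2^-1 *: (A + k *: C - k *: E))^T =
    2^-1 *: (A^T + k *: C^T - k *: E^T) by apply/matrixP => i j; rewrite !mxE.
have spV := so_proj_a V; have spB := so_proj_a B; rewrite trL !comT sV.
move: (proj_a V) (proj_a B) spV spB => pV pB -> ->; by mx_field.
Qed.

(** P commutes with transposition, so F + F^T solves the same linear equation as
    F; it starts at 0, hence stays 0. *)
Lemma so_expv_transport_op V B t : so V -> so B ->
  so (expv (fun A => t *: transport_op alpha V A) B).
Proof.
move=> sV sB; pose F s := expv (fun A => s *: transport_op alpha V A) B.
have dG (s : R) : is_derive s (1 : R) (fun s => F s + (F s)^T)
    (transport_op alpha V (F s + (F s)^T)).
  have dF := is_derive_expv (@transport_op R d m alpha V) B s.
  have := is_deriveD dF (is_derive_linear_mx trmx dF).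
  move/is_derive_eq; apply; rewrite [RHS]linearD/=.
  by rewrite trmx_transport_op.
have F0 : F 0 = B by exact: expv0.
have := operator_ode_unique dG t; rewrite F0 sB subrr.
rewrite expvE linear0 mul0mx linear0 => /eqP.
by rewrite addrC addr_eq0 => /eqP.
Qed.

(** For a field L F q in the frame below, the two exponential factors contribute
    U F + F K to the covariant derivative and the connection contributes
    nabla_V F - V F; together they amount to - P_V F. *)
Lemma transport_opE V B : transport_op alpha V B =
  V *m B - (V - k *: proj_a V) *m B - B *m (k *: proj_a V) - left_connection alpha V B.
Proof.
rewrite /transport_op /left_connection; move: (proj_a V) (proj_a B) => pV pB.
by mx_field.
Qed.

Lemma transport_op_self V : transport_op alpha V V = 0.
Proof. by rewrite /transport_op; move: (proj_a V) => pV; mx_field. Qed.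

Lemma left_connection_self V :
  left_connection alpha V V = k *: commutator_mx (proj_a V) V.
Proof. by rewrite /left_connection; move: (proj_a V) => pV; mx_field. Qed.

Lemma commutator_conj Q A B : Q *m Q^T = 1%:M ->
  commutator_mx (Q^T *m A *m Q) (Q^T *m B *m Q) = Q^T *m commutator_mx A B *m Q.
Proof.
move=> QQ; have QK C D : Q^T *m C *m Q *m (Q^T *m D *m Q) = Q^T *m (C *m D) *m Q.
  by rewrite !mulmxA -(mulmxA _ Q Q^T) QQ mulmx1.
by rewrite /commutator_mx !QK -mulmxBl -mulmxBr.
Qed.

(** Orthogonal matrices that commute with J act by conjugation as automorphisms
    that commute with P, and the connection is made of brackets and P. *)
Lemma left_connection_conj Q V B : Q *m Q^T = 1%:M ->
  Q *m idblock = idblock *m Q ->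
  left_connection alpha (Q^T *m V *m Q) (Q^T *m B *m Q) =
  Q^T *m left_connection alpha V B *m Q.
Proof.
move=> QQ QJ; have QTJ : Q^T *m idblock = idblock *m Q^T.
  by rewrite -trmx_idblock -!trmx_mul QJ.
have pQ C : proj_a (Q^T *m C *m Q) = Q^T *m proj_a C *m Q.
  by rewrite -{2}[Q]trmxK proj_a_conj// trmxK.
rewrite /left_connection !pQ !commutator_conj//.
move: (commutator_mx _ _) (commutator_mx _ _) (commutator_mx _ _) => x y z.
by mx_field.
Qed.

End TransportOperator.

Section Frame.
Context {R : realType} {d m : nat} (alpha : R).
Local Notation M := 'M[R]_(d + m).
Local Notation k := (1 - 2 * alpha).
Context (X V : M).
Context (SX : SO X) (sV : so V).
Let K : M := k *: proj_a V.
Let U : M := V - K.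
Let L (t : R) : M := X *m mexp (t *: U).
Let q (t : R) : M := mexp (t *: K).
Implicit Types (F : R -> M) (t : R).

Let sK : so K. Proof. by apply: soZ; exact: so_proj_a. Qed.
Let sU : so U. Proof. by apply: soD => //; exact: soN. Qed.

Lemma SO_frame t : SO (L t).
Proof. by apply: SO_mulmx => //; exact: SO_mexp. Qed.

Lemma SO_coframe t : SO (q t).
Proof. exact: SO_mexp. Qed.

Lemma coframe_idblock t : q t *m idblock = idblock *m q t.
Proof.
apply: comm_mexp; rewrite -!scalemxAl -!scalemxAr; congr (_ *: (_ *: _)).
by rewrite proj_aJ Jproj_a.
Qed.

(** All the curves of the theorem have the form L F q with L = X exp(tU) and
    q = exp(tK): F = 1 is the geodesic, F = V its velocity, and a general F a
    field along it. *)
Lemma is_derive_framed F t dF : is_derive t (1 : R) F dF ->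
  is_derive t (1 : R) (fun s => L s *m F s *m q s)
    (L t *m (U *m F t + dF + F t *m K) *m q t).
Proof.
move=> dFt; have dL : is_derive t (1 : R) L (L t *m U).
  apply: is_derive_eq.
    exact: (is_derive_linear_mx (mulmx X) (is_derive_mexp U t)).
  by rewrite /= mulmxA.
apply: is_derive_eq.
  apply: is_derive_mulmx (is_derive_mexp K t).
  exact: is_derive_mulmx dL dFt.
have distr (l u f f' w e : M) : (l *m u *m f + l *m f') *m e + l *m f *m (w *m e)
    = l *m (u *m f + f' + f *m w) *m e.
  by rewrite !mulmxDr !mulmxDl !mulmxA.
by rewrite (comm_mexpZ K); exact: distr.
Qed.

Lemma framedE F t : L t *m F t *m q t =
  L t *m q t *m ((q t)^T *m F t *m q t).
Proof.
rewrite !mulmxA -(mulmxA _ (q t) (q t)^T) SO_mulmxT ?mulmx1//.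
exact: SO_coframe.
Qed.

Lemma is_derive_geodesic t :
  is_derive t (1 : R) (fun s => L s *m q s) (L t *m V *m q t).
Proof.
have := is_derive_framed (is_derive_cst (1%:M : M) t 1).
rewrite mulmx1 mul1mx addr0 subrK.
by have -> : (fun s => L s *m cst 1%:M s *m q s) = (fun s => L s *m q s)
  by apply/funext => s; rewrite mulmx1.
Qed.

(** In this moving frame the covariant derivative along the geodesic becomes
    F' - P_V F, an operator with constant coefficients.  Parallel fields are thus
    the solutions of F' = P_V F, and the constant F = V is one of them because
    P_V V = 0, which is the geodesic equation. *)
Lemma covariant_derivative_framed Gam F t dF :
  (forall Y W B, SO Y -> so W -> so B ->
     Gam Y (Y *m W) (Y *m B) = Y *m (left_connection alpha W B - W *m B)) ->
  so (F t) -> is_derive t (1 : R) F dF ->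
  covariant_derivative Gam (fun s => L s *m q s) (fun s => L s *m F s *m q s) t
  = L t *m (dF - transport_op alpha V (F t)) *m q t.
Proof.
move=> GamE sF dFt; rewrite /covariant_derivative !derive1E.
have [_ ->] := is_derive_framed dFt; have [_ ->] := is_derive_geodesic t.
have qq := SO_mulmxT (SO_coframe t).
rewrite (framedE (fun=> V)) (framedE F) GamE.
- rewrite left_connection_conj//; last exact: coframe_idblock.
  have -> : (q t)^T *m V *m q t *m ((q t)^T *m F t *m q t) =
      (q t)^T *m (V *m F t) *m q t.
    by rewrite !mulmxA -(mulmxA _ (q t) (q t)^T) qq mulmx1.
  rewrite -mulmxBl -mulmxBr.
  have -> : L t *m q t *m ((q t)^T *m (left_connection alpha V (F t) - V *m F t) *m q t)
      = L t *m (left_connection alpha V (F t) - V *m F t) *m q t.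
    by rewrite -(framedE (fun=> _)).
  rewrite -mulmxDl -mulmxDr transport_opE; congr (_ *m _ *m _).
  rewrite -/K -/U; move: (left_connection _ _ _) (U *m _) (V *m _) (_ *m K) => a b c e.
  by apply/matrixP => i j; rewrite !(entryD, entryN); ring.
- by apply: SO_mulmx; [exact: SO_frame|exact: SO_coframe].
- by rewrite -{2}[q t]trmxK; exact: so_conj.
- by rewrite -{2}[q t]trmxK; exact: so_conj.
Qed.

Section Equations.
Context (Gam : M -> M -> M -> M).
Context (GamE : forall Y W B, SO Y -> so W -> so B ->
  Gam Y (Y *m W) (Y *m B) = Y *m (left_connection alpha W B - W *m B)).

Lemma frame0 : L 0 = X.
Proof. by rewrite /L scale0r mexp0 mulmx1. Qed.

Lemma coframe0 : q 0 = 1%:M.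
Proof. by rewrite /q scale0r mexp0. Qed.

Lemma derive1_is_derive (W : normedModType R) (f df : R -> W) :
  (forall t : R, is_derive t (1 : R) f (df t)) -> derive1 f = df.
Proof. by move=> f'; apply/funext => t; rewrite derive1E; have [] := f' t. Qed.

Lemma geodesic_framed : geodesic Gam (fun s => L s *m q s).
Proof.
have cE := derive1_is_derive is_derive_geodesic.
move=> t; split.
- by apply: SO_mulmx; [exact: SO_frame|exact: SO_coframe].
- by have [] := is_derive_geodesic t.
- by rewrite cE; have [] := is_derive_framed (is_derive_cst V t 1).
- rewrite cE (covariant_derivative_framed GamE _ (is_derive_cst V t 1))//.
  by rewrite transport_op_self subrr mulmx0 mul0mx.
Qed.

(** The nonlinear geodesic equation is solved by quadratures: the body velocity
    v = c^T c' satisfies v' = - (1 - 2 alpha) [P v, v], along which P v is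
    constant, so that the equation becomes linear. *)
Lemma geodesic_unique c : geodesic Gam c -> c 0 = X -> derive1 c 0 = X *m V ->
  forall t, c t = L t *m q t.
Proof.
move=> cg c0 c'0; pose v t := (c t)^T *m derive1 c t.
have Sc t : SO (c t) by have [] := cg t.
have dc t : is_derive t (1 : R) c (c t *m v t).
  have [_ dct _ _] := cg t; apply: is_derive_eq; first exact: derivableP.
  by rewrite /v mulmxA SO_mulmxT// mul1mx derive1E.
have dcT t : is_derive t (1 : R) (fun s => (c s)^T) ((c t *m v t)^T).
  exact: (is_derive_linear_mx trmx (dc t)).
have c'E : derive1 c = fun t => c t *m v t by exact: derive1_is_derive.
have cK t (B : M) : (c t)^T *m (c t *m B) = B by rewrite mulmxA (Sc t).1 mul1mx.
(* Differentiate c^T c = 1. *)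
have sv t : so (v t).
  have [_ D1] := is_derive_mulmx (dcT t) (dc t).
  have cc : (fun s => (c s)^T *m c s) = fun=> 1%:M.
    by apply/funext => s; have [] := Sc s.
  move: D1; rewrite cc derive_cst cK trmx_mul -mulmxA (Sc t).1 mulmx1.
  by move=> /esym/eqP; rewrite addr_eq0 => /eqP.
(* Euler-Arnold equation of the body velocity v. *)
have dv t : is_derive t (1 : R) v (- (k *: commutator_mx (proj_a (v t)) (v t))).
  have [_ _ ddc covc] := cg t.
  have ddcE : 'D_1 (derive1 c) t = - Gam (c t) (derive1 c t) (derive1 c t).
    by apply/eqP; rewrite -addr_eq0 -derive1E; apply/eqP.
  apply: is_derive_eq.
    exact: is_derive_mulmx (dcT t) (derivableP ddc).
  rewrite ddcE c'E (GamE (Sc t) (sv t) (sv t)) left_connection_self trmx_mul (sv t).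
  by rewrite -mulmxA cK mulmxN cK mulNmx opprB addrA addNr add0r.
(* The a-component of v is conserved: P[Pv, v] = [Pv, Pv] = 0. *)
have Pv t : proj_a (v t) = proj_a V.
  have v0 : v 0 = V by rewrite /v c'0 c0 mulmxA SX.1 mul1mx.
  rewrite -v0; apply: (is_derive_0_mx_cst (F := fun s => proj_a (v s))) => s.
  apply: is_derive_eq; first exact: (is_derive_linear_mx (@proj_a R d m) (dv s)).
  rewrite /= linearN/= linearZ/= proj_a_commutator//.
  by rewrite /commutator_mx subrr scaler0 oppr0.
have v0 : v 0 = V by rewrite /v c'0 c0 mulmxA SX.1 mul1mx.
have dq t : is_derive t (1 : R) q (q t *m K) by exact: is_derive_mexp.
have dqT t : is_derive t (1 : R) (fun s => (q s)^T) (- (K *m (q t)^T)).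
  apply: is_derive_eq; first exact: (is_derive_linear_mx trmx (dq t)).
  by rewrite /= trmx_mul sK mulNmx.
have cancel (Q W B Q' : M) : (Q *m W *m B + Q *m - (W *m B - B *m W)) *m Q'
    + Q *m B *m - (W *m Q') = 0.
  by mx_field.
have KE (B : M) : k *: commutator_mx (proj_a V) B = K *m B - B *m K.
  by rewrite /K -scalemxAl -scalemxAr -scalerBr.
have z' (s : R) : is_derive s (1 : R) (fun s => q s *m v s *m (q s)^T) 0.
  apply: is_derive_eq.
    exact: is_derive_mulmx (is_derive_mulmx (dq s) (dv s)) (dqT s).
  by rewrite Pv KE; exact: cancel.
(* Hence v solves the linear equation v' = - [K, v], that is v = q^T V q. *)
have zE t : q t *m v t *m (q t)^T = V.
  by rewrite (is_derive_0_mx_cst z' t) coframe0 trmx1 mul1mx mulmx1.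
have qTK t : (q t)^T *m K = K *m (q t)^T.
  have tK : (t *: K)^T = t *: - K by rewrite -sK linearZ.
  have comt (A : M) : (t *: - A) *m A = A *m (t *: - A).
    by rewrite -!scalemxAl -!scalemxAr mulNmx mulmxN.
  by rewrite /q trmx_mexp tK; apply: comm_mexp; exact: comt.
have w' (s : R) : is_derive s (1 : R) (fun s => c s *m (q s)^T)
    (c s *m (q s)^T *m U).
  apply: is_derive_eq; first exact: is_derive_mulmx (dc s) (dqT s).
  have vV : (q s)^T *m V = v s *m (q s)^T.
    by rewrite -(zE s) -mulmxA mulmxA (SO_coframe s).1 mul1mx.
  have qTU : (q s)^T *m U = v s *m (q s)^T - K *m (q s)^T.
    by rewrite -vV -qTK -mulmxBr.
  have distr (a w Q W : M) : a *m w *m Q + a *m - W = a *m (w *m Q - W).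
    by rewrite mulmxBr mulmxN mulmxA.
  by rewrite -[RHS]mulmxA qTU; exact: distr.
have wE t : c t *m (q t)^T = L t.
  by rewrite (linear_ode_unique w' t) c0 coframe0 trmx1 mulmx1.
by move=> t; rewrite -wE -mulmxA (SO_coframe t).1 mulmx1.
Qed.

Let expP (B : M) (s : R) : M := expv (fun A => s *: transport_op alpha V A) B.

Lemma parallel_framed (B : M) : so B ->
  parallel_along Gam (fun s => L s *m q s) (fun s => L s *m expP B s *m q s).
Proof.
move=> sB t; have dF := is_derive_expv (@transport_op R d m alpha V) B t.
have sF : so (expP B t) by exact: so_expv_transport_op.
split.
- rewrite framedE; exists ((q t)^T *m expP B t *m q t) => //.
  by rewrite -{2}[q t]trmxK; exact: so_conj.
- by have [] := is_derive_framed dF.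
- rewrite (covariant_derivative_framed GamE sF dF) subrr.
  by rewrite mulmx0 mul0mx.
Qed.

(** Read the given field in the moving frame and apply uniqueness for the linear
    equation F' = P_V F. *)
Lemma parallel_unique (E : R -> M) :
  parallel_along Gam (fun s => L s *m q s) E ->
  forall t, E t = L t *m expP (X^T *m E 0) t *m q t.
Proof.
move=> pE; pose G t := (L t)^T *m E t *m (q t)^T.
have EG t : E t = L t *m G t *m q t.
  rewrite /G !mulmxA SO_mulmxT ?mul1mx; last exact: SO_frame.
  by rewrite -mulmxA (SO_coframe t).1 mulmx1.
have EGfun : E = fun s => L s *m G s *m q s by apply/funext.
(* For arbitrary factors, so that associativity is not applied inside L. *)
have unframe (l Q A Q' : M) :
    l^T *m (l *m Q *m A) *m Q' = l^T *m l *m (Q *m A *m Q') by rewrite !mulmxA.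
have sG t : so (G t).
  have [[B sB EB] _ _] := pE t.
  have -> : G t = q t *m B *m (q t)^T.
    by rewrite /G -EB unframe (SO_frame t).1 mul1mx.
  exact: so_conj.
have dG t : is_derive t (1 : R) G ('D_1 G t).
  apply: derivableP; have [_ dE _] := pE t.
  have dL : is_derive t (1 : R) L (X *m (mexp (t *: U) *m U)).
    exact: (is_derive_linear_mx (mulmx X) (is_derive_mexp U t)).
  have dLT := is_derive_linear_mx trmx dL.
  have dqT := is_derive_linear_mx trmx (is_derive_mexp K t).
  by have [] := is_derive_mulmx (is_derive_mulmx dLT (derivableP dE)) dqT.
have dGP (t : R) : is_derive t (1 : R) G (transport_op alpha V (G t)).
  suff <- : 'D_1 G t = transport_op alpha V (G t) by exact: dG.
  have [_ _] := pE t; rewrite EGfun (covariant_derivative_framed GamE (sG t) (dG t)).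
  move=> LDq; apply/eqP; rewrite -subr_eq0; apply/eqP.
  move: (_ - _) LDq => D LDq.
  have := congr1 (fun A => (L t)^T *m A *m (q t)^T) LDq.
  rewrite unframe (SO_frame t).1 mul1mx mulmx0 mul0mx -mulmxA.
  by rewrite SO_mulmxT ?mulmx1//; exact: SO_coframe.
move=> t; rewrite EG (operator_ode_unique dGP t); congr (_ *m expv _ _ *m _).
by rewrite /G frame0 coframe0 trmx1 mulmx1.
Qed.

End Equations.
End Frame.

(** * Block matrices and the explicit formulas *)

Section Blocks.
Context {R : realType} {d m : nat} (alpha : R).
Context (A : 'M[R]_d) (B : 'M[R]_(m, d)) (C : 'M[R]_m).
Context (sA : so A).

Lemma so_block : so C -> so (block_mx A (- B^T) B C).
Proof.
move=> sC; rewrite /so/= tr_block_mx linearN/= trmxK sA sC opp_block_mx.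
by rewrite opprK.
Qed.

Lemma proj_a_block (B' : 'M[R]_(d, m)) :
  proj_a (block_mx A B' B C) = block_mx A 0 0 0.
Proof.
rewrite /proj_a block_mxKul sA opprK scalerDr -scalerDl.
by rewrite (_ : 2^-1 + 2^-1 = 1 :> R) ?scale1r//; field.
Qed.

End Blocks.

Theorem proposition5 (R : realType) (d m : nat) (alpha : R)
    (hd : (1 <= d)%N) (halpha : alpha != 0) :
  let g : 'M[R]_(d + m) -> 'M[R]_(d + m) -> 'M[R]_(d + m) -> R :=
    left_invariant_metric (form_beta (- 2^-1) alpha) in
  [/\ exists nabla, levi_civita g nabla,
      forall nabla, levi_civita g nabla ->
        exists Gam, christoffel_function nabla Gam
    &
  forall (X : 'M[R]_(d + m)) (Axi Aeta : 'M[R]_d) (Bxi Beta : 'M[R]_(m, d))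
    (Cxi Ceta : 'M[R]_m),
  SO X -> so Axi -> so Aeta -> so Cxi -> so Ceta ->
  let xi := X *m block_mx Axi (- Bxi^T) Bxi Cxi in
  let eta := X *m block_mx Aeta (- Beta^T) Beta Ceta in
  let gamma := fun t : R =>
    X *m mexp (t *: block_mx ((2 * alpha) *: Axi) (- Bxi^T) Bxi Cxi)
      *m mexp (t *: block_mx ((1 - 2 * alpha) *: Axi) 0 0 0) in
  [/\ (* metric *)
      g X xi eta = 2^-1 * \tr (xi^T *m eta)
        + (alpha - 2^-1) * \tr (proj_a (xi^T *m X) *m proj_a (X^T *m eta)),
      g X xi eta = 2^-1 * \tr (xi^T *m eta)
        + (alpha - 2^-1) * \tr (Axi^T *m Aeta)
    & forall nabla Gam,
      levi_civita g nabla -> christoffel_function nabla Gam ->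
  [/\ (* Christoffel function *)
      Gam X xi eta = 2^-1 *: (X *m (xi^T *m eta + eta^T *m xi))
        + ((1 - 2 * alpha) / 2) *:
          (X *m (commutator_mx (proj_a (X^T *m xi)) (X^T *m eta)
                 + commutator_mx (proj_a (X^T *m eta)) (X^T *m xi)))
      /\ Gam X xi eta = 2^-1 *: (X *m (xi^T *m eta + eta^T *m xi))
        + ((1 - 2 * alpha) / 2) *:
          (X *m block_mx 0 (- (Axi *m Beta^T) - Aeta *m Bxi^T)
                         (- (Beta *m Axi) - Bxi *m Aeta) 0),
      (* geodesic *)
      forall c : R -> 'M[R]_(d + m),
        [/\ geodesic Gam c, c 0 = X & derive1 c 0 = xi] <->
        (forall t, c t = gamma t)
    & (* parallel transport *)
      forall E : R -> 'M[R]_(d + m),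
        (parallel_along Gam gamma E /\ E 0 = eta) <->
        (forall t, E t =
           X *m mexp (t *: block_mx ((2 * alpha) *: Axi) (- Bxi^T) Bxi Cxi)
             *m expv (fun B => t *: transport_op alpha (X^T *m xi) B)
                     (X^T *m eta)
             *m mexp (t *: block_mx ((1 - 2 * alpha) *: Axi) 0 0 0))]]].
Proof.
move=> g; split.
- by exists (metric_connection alpha); exact: levi_civita_metric_connection.
- move=> nabla LC; exists (christoffel_formula alpha) => Y Z fY fZ X SX.
  have LC0 := @levi_civita_metric_connection R d m alpha.
  by rewrite (levi_civita_unique halpha LC LC0 fY fZ SX).
move=> X Axi Aeta Bxi Beta Cxi Ceta SX sAxi sAeta sCxi sCeta xi eta gamma.
pose V := block_mx Axi (- Bxi^T) Bxi Cxi.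
pose W := block_mx Aeta (- Beta^T) Beta Ceta.
have sV : so V by exact: so_block.
have sW : so W by exact: so_block.
have PV : proj_a V = block_mx Axi 0 0 0 by exact: proj_a_block.
have PW : proj_a W = block_mx Aeta 0 0 0 by exact: proj_a_block.
have XK (U : 'M[R]_(d + m)) : X^T *m (X *m U) = U by rewrite mulmxA SX.1 mul1mx.
have Xxi : X^T *m xi = V by exact: XK.
have Xeta : X^T *m eta = W by exact: XK.
have KE : (1 - 2 * alpha) *: proj_a V = block_mx ((1 - 2 * alpha) *: Axi) 0 0 0.
  by rewrite PV scale_block_mx !scaler0.
have UE : V - (1 - 2 * alpha) *: proj_a V =
    block_mx ((2 * alpha) *: Axi) (- Bxi^T) Bxi Cxi.
  rewrite KE /V opp_block_mx add_block_mx !oppr0 !addr0.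
  by rewrite scalerBl scale1r opprB addrCA subrr addr0.
have trA : \tr (block_mx Axi 0 0 (0 : 'M[R]_m) *m block_mx Aeta 0 0 0) =
    - \tr (Axi^T *m Aeta).
  rewrite mulmx_block !(mulmx0, mul0mx, addr0) mxtrace_block mxtrace0 addr0.
  by rewrite sAxi mulNmx linearN opprK.
have gE : g X xi eta = 2^-1 * \tr (xi^T *m eta)
    + (alpha - 2^-1) * \tr (Axi^T *m Aeta).
  rewrite /g /left_invariant_metric (SO_invmx SX) Xxi Xeta /form_beta PV PW trA.
  rewrite /xi -/V trmx_mul -mulmxA Xeta sV mulNmx linearN/=.
  by move: (\tr _) (\tr _) => x y; ring.
split=> //.
- rewrite gE; congr (_ + _ * _).
  have -> : xi^T *m X = - V by rewrite -sV -Xxi [(X^T *m xi)^T]trmx_mul trmxK.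
  by rewrite linearN/= mulNmx linearN/= Xeta PV PW trA opprK.
move=> nabla Gam LC GamE.
have GamF Y Z B : SO Y -> so Z -> so B ->
    Gam Y (Y *m Z) (Y *m B) = Y *m (left_connection alpha Z B - Z *m B).
  move=> SY sZ sB; rewrite (christoffel_unique halpha LC GamE SY sZ sB).
  exact: christoffel_formulaE.
split.
- have GE := christoffel_unique halpha LC GamE SX sV sW.
  split; first exact: GE.
  rewrite [LHS]GE /christoffel_formula -/xi -/eta Xxi Xeta PV PW.
  congr (_ + _ *: (X *m _)).
  rewrite /commutator_mx /V /W !mulmx_block !(mulmx0, mul0mx, addr0, add0r).
  rewrite !opp_block_mx !add_block_mx.
  by rewrite addrA subrK !subrr !subr0 !sub0r !mulmxN addr0.
- move=> c; split=> [[cg c0 c'0] t|cE].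
    by rewrite (geodesic_unique SX GamF cg c0 c'0 t) UE KE.
  have -> : c = fun s => X *m mexp (s *: (V - (1 - 2 * alpha) *: proj_a V))
      *m mexp (s *: ((1 - 2 * alpha) *: proj_a V)).
    by apply/funext => s; rewrite cE UE KE.
  split; first exact: (geodesic_framed SX sV GamF).
    by rewrite !scale0r !mexp0 !mulmx1.
  rewrite derive1E; have [_ ->] := is_derive_geodesic alpha X V 0.
  by rewrite !scale0r !mexp0 !mulmx1.
- move=> E; rewrite Xxi Xeta /gamma -UE -KE; split=> [[pE E0] t|EE].
    by rewrite (parallel_unique SX sV GamF pE t) E0 Xeta.
  have -> : E = fun t => X *m mexp (t *: (V - (1 - 2 * alpha) *: proj_a V))
      *m expv (fun B => t *: transport_op alpha V B) W
      *m mexp (t *: ((1 - 2 * alpha) *: proj_a V)) by exact/funext.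
  split; first exact: (parallel_framed SX sV GamF sW).
  by rewrite !scale0r !mexp0 !mulmx1 expv0.
Qed.
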